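(* There exists $\Delta_0$ such that the following holds. Let $G$ be a multigraph with maximum degree $\Delta > \Delta_0$ and no cycles of length $3$ or $4$, with an assignment of lists $L(v)\subset\mathbb{N}$ to the vertices $v$ such that $|L(v)| \geq 50\sqrt{\Delta/\ln\Delta}$ for each vertex $v$, and let $\tau$ be an edge labelling of $G$ by ordered pairs of colours with conflict degree $D(\tau) \leq \Delta^{1/5}$. Then there exists a proper conflict colouring of $G$ from these lists.
   Context: Multigraphs are finite and loopless; parallel edges (i.e. cycles of length 2) are allowed. Cycles of length 3 or 4 pass through 3 or 4 distinct vertices respectively. The degree of a vertex is the number of edges incident to it, counted with multiplicity, and the maximum degree is the largest degree of a vertex. An edge labelling is a map $\tau:E\to\mathbb{N}\times\mathbb{N}$ on the edge set of $G=(V,E)$, where for each edge it is specified which endpoint corresponds to which coordinate of the label. For an edge $e$ with endpoints $u,v$, writing $e=uv$ and $\tau(e)=(c,c')$ means that $c$ is the coordinate corresponding to $u$ and $c'$ the coordinate corresponding to $v$ (so, written as $e=vu$, the same label reads $(c',c)$). Such a label forbids $u$ from receiving $c$ and $v$ from receiving $c'$ simultaneously. A proper conflict colouring of $G$ from lists $L(v)$ is a map $\sigma$ with $\sigma(v)\in L(v)$ for every $v\in V$ such that there is no edge $e=uv$ with $\tau(e)=(\sigma(u),\sigma(v))$. For a colour $c$ and vertices $u,v$, let $d(\tau,c,u,v)$ be the number of edges $e=uv$ such that $\tau(e)=(c,c')$ for some colour $c'$ (with $c$ corresponding to $u$). The conflict degree $D(\tau)$ is the maximum of $d(\tau,c,u,v)$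 over all colours $c$ and all (ordered) pairs $u,v$. *)

(* Defs.v *)
From mathcomp Require Import all_boot all_order all_algebra.
From mathcomp Require Import all_classical all_reals all_analysis.

Set Implicit Arguments.
Unset Strict Implicit.
Unset Printing Implicit Defensive.

(* Edges are abstract, so several of them may have the same ends. *)
Record multigraph := Multigraph {
  vertex : finType;
  edge : finType;
  ends : edge -> {set vertex};
  card_ends : forall e, #|ends e| = 2 }.

Definition degree (G : multigraph) (v : vertex G) : nat :=
  #|[pred e : edge G | v \in ends e]|.

Definition max_degree (G : multigraph) : nat :=
  \max_(v : vertex G) degree v.

(* [ordS] is the cyclic successor of 'I_k.  As the edges of a cycle are
   distinct too, a cycle of length 2 is a pair of parallel edges. *)
Definition has_cycle (G : multigraph) (k : nat) : Prop :=
  exists (v : 'I_k -> vertex G) (e : 'I_k -> edge G),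
    [/\ injective v, injective e
      & forall i, ends (e i) = [set v i; v (ordS i)]%SET].

(* The coordinates [(label e).1] and [(label e).2] correspond to the ends
   [end1 e] and [end2 e] of [e], respectively. *)
Record edge_labelling (G : multigraph) := EdgeLabelling {
  label : edge G -> nat * nat;
  end1 : edge G -> vertex G;
  end2 : edge G -> vertex G;
  end12 : forall e, ends e = [set end1 e; end2 e]%SET }.

(* e = uv and tau(e) = (c, c'), with c corresponding to u and c' to v *)
Definition labelled (G : multigraph) (tau : edge_labelling G) (e : edge G)
    (u v : vertex G) (c c' : nat) : bool :=
  [&& end1 tau e == u, end2 tau e == v & label tau e == (c, c')] ||
  [&& end1 tau e == v, end2 tau e == u & label tau e == (c', c)].

Definition conflict_count (G : multigraph) (tau : edge_labelling G)
    (c : nat) (u v : vertex G) : nat :=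
  #|[pred e : edge G | `[< exists c', labelled tau e u v c c' >]]|.

Definition label_colours (G : multigraph) (tau : edge_labelling G) : seq nat :=
  [seq (label tau e).1 | e : edge G] ++ [seq (label tau e).2 | e : edge G].

(* The maximum of [conflict_count tau c u v] over all c, u and v: the count is
   0 if c occurs in no label; see [conflict_degreeP]. *)
Definition conflict_degree (G : multigraph) (tau : edge_labelling G) : nat :=
  \max_(c <- label_colours tau) \max_(u : vertex G) \max_(v : vertex G)
    conflict_count tau c u v.

Lemma conflict_count_eq0 (G : multigraph) (tau : edge_labelling G) c u v :
  c \notin label_colours tau -> conflict_count tau c u v = 0.
Proof.
move=> cN; apply: eq_card0 => e; rewrite !inE; apply/asboolP => -[c'].
by case/orP => /and3P[_ _ /eqP lab]; case/negP: cN; rewrite mem_cat;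
  apply/orP; [left|right]; apply/mapP; exists e; rewrite ?mem_enum ?lab.
Qed.

Lemma conflict_degreeP (G : multigraph) (tau : edge_labelling G) (k : nat) :
  conflict_degree tau <= k <-> forall c u v, conflict_count tau c u v <= k.
Proof.
split=> [le_k c u v | le_k]; last first.
  by apply/bigmax_leqP_seq => c _ _; apply/bigmax_leqP => u _; apply/bigmax_leqP.
have [cL|/conflict_count_eq0 ->//] := boolP (c \in label_colours tau).
move/bigmax_leqP_seq: le_k => /(_ c cL isT).
by move/bigmax_leqP => /(_ u isT); move/bigmax_leqP; apply.
Qed.

Definition proper_conflict_colouring (G : multigraph)
    (L : vertex G -> set nat) (tau : edge_labelling G)
    (sigma : vertex G -> nat) : Prop :=
  (forall v, L v (sigma v)) /\
  ~ (exists e u v, labelled tau e u v (sigma u) (sigma v)).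

(* Main.v *)
(* Make every colour c of every vertex v a node, and join two nodes when some
   edge forbids the corresponding pair of colours; we look for an independent
   set of nodes meeting every list.  Let l be the size of the lists and t a
   bound on the degrees of the nodes, after dropping the nodes whose degree is
   more than twice the average.  If 16 t <= l, choosing uniformly from the
   lists works by the local lemma.  Otherwise a nibble lowers t / l: every node
   is tried with probability 1 / (16 t), at most one per list, all nodes in
   conflict with a tried node are deleted, a vertex whose tried node survives
   is coloured, and independent coins make every node survive with probability
   exactly 15/16.  Lists shrink by 15/16, degrees by 15/16 and by the
   proportion of newly coloured neighbours, so that t / l drops by at least
   1/128.  Initially t / l <= ln Delta / 625, hence about ln Delta / 5 rounds
   suffice, and they cost only a factor Delta^(-0.03) in l; so l stays much
   larger than the conflict degree, and both quantities are concentrated.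
   For the degree of a node at v one first fixes the choice at v: as there are
   no cycles of length 3 or 4, the neighbours of v then behave independently. *)

Require Import Defs.
From mathcomp Require Import all_boot all_order all_algebra.
From mathcomp Require Import all_classical all_reals all_analysis.
From mathcomp Require Import ring lra.

Set Implicit Arguments.
Unset Strict Implicit.
Unset Printing Implicit Defensive.

Import Order.TTheory GRing.Theory Num.Theory.
Local Open Scope ring_scope.

(** * Product probability spaces *)

(** Weierstrass's product inequality. Carrying nonnegativity of the sum through the induction makes
    the cross term harmless. *)
Lemma weierstrass_prod (R : realDomainType) (K : finType) (P : pred K) (a : K -> R) :
  (forall k, P k -> 0 <= a k <= 1) ->
  1 - \sum_(k | P k) a k <= \prod_(k | P k) (1 - a k).
Proof.
move=> a01.
suff [] : 0 <= \sum_(k | P k) a k /\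
  1 - \sum_(k | P k) a k <= \prod_(k | P k) (1 - a k) by [].
elim/big_rec2: _ => [|k y z Pk [y0 yz]]; first by rewrite subr0.
by have /andP[a0 a1] := a01 k Pk; split; nra.
Qed.

(** Multiply by [1 - z], which is at most [expR (- z)]: the left side becomes at most 1, and the
    right side is 1 + z^2 (1 - 2z). *)
Lemma expR_le_quad (R : realType) (z : R) : z <= 2^-1 ->
  expR z <= 1 + z + 2 * z ^+ 2.
Proof.
move=> z2; have z1 : 0 < 1 - z by lra.
rewrite -(ler_pM2r z1); apply: (@le_trans _ _ 1).
  by rewrite -[leRHS](expRxMexpNx_1 z) ler_wpM2l ?expR_ge0 ?expR_ge1Dx.
by have := mulr_ge0 (sqr_ge0 z) (_ : 0 <= 1 - 2 * z); rewrite -subr_ge0; nra.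
Qed.

Section ProductSpace.
Import mathcomp.boot.fintype mathcomp.boot.finset.
Variables (R : realType) (I T : finType) (t0 : T) (w : I -> T -> R).
Hypothesis w_ge0 : forall i y, 0 <= w i y.
Hypothesis w_sum : forall i, \sum_y w i y = 1.
Implicit Types (F G : (I -> T) -> R) (f g : I -> T) (s : seq I) (S : {set I}).

Definition upd f i y : I -> T := fun j => if j == i then y else f j.
Definition av i F : (I -> T) -> R := fun f => \sum_y w i y * F (upd f i y).
Fixpoint avs s F : (I -> T) -> R := if s is i :: s' then avs s' (av i F) else F.
(** An iterated average over independent coordinates, so that its properties follow by induction on
    the coordinates; [t0] supplies a point at which to evaluate the resulting constant. *)
Definition expect F : R := avs (enum I) F (fun=> t0).
Definition supported F S : Prop :=
  forall f g, (forall i, i \in S -> f i = g i) -> F f = F g.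

Lemma upd_eq f i y : upd f i y i = y.
Proof. by rewrite /upd eqxx. Qed.

Lemma upd_neq f i j y : j != i -> upd f i y j = f j.
Proof. by rewrite /upd => /negbTE ->. Qed.

Lemma upd_upd f i y z : upd (upd f i y) i z = upd f i z.
Proof. by apply/funext => j; rewrite /upd; case: eqP. Qed.

Lemma upd_comm f i j y z : i != j -> upd (upd f i y) j z = upd (upd f j z) i y.
Proof.
move=> ij; apply/funext => k; rewrite /upd.
by case: (k =P j) => // ->; rewrite eq_sym (negbTE ij).
Qed.

Lemma avD i F G : av i (fun f => F f + G f) = (fun f => av i F f + av i G f).
Proof.
by apply/funext => f; rewrite /av -big_split; apply: eq_bigr => y _; rewrite mulrDr.
Qed.

Lemma avZ i a F : av i (fun f => a * F f) = (fun f => a * av i F f).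
Proof.
by apply/funext => f; rewrite /av mulr_sumr; apply: eq_bigr => y _; rewrite mulrCA.
Qed.

Lemma av_le i F G : (forall f, F f <= G f) -> forall f, av i F f <= av i G f.
Proof. by move=> FG f; apply: ler_sum => y _; apply: ler_wpM2l. Qed.

Lemma av_constM i F G f : (forall y, G (upd f i y) = G f) ->
  av i (fun f => G f * F f) f = G f * av i F f.
Proof.
by move=> Gf; rewrite /av mulr_sumr; apply: eq_bigr => y _; rewrite Gf mulrCA.
Qed.

Lemma av_const i F f : (forall y, F (upd f i y) = F f) -> av i F f = F f.
Proof.
by move=> Ff; under [LHS]eq_bigr do rewrite Ff; rewrite -mulr_suml w_sum mul1r.
Qed.

Lemma av_upd i F f y : av i F (upd f i y) = av i F f.
Proof. by apply: eq_bigr => z _; rewrite upd_upd. Qed.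

Lemma av_comm i j F : av i (av j F) = av j (av i F).
Proof.
have [->//|ij] := eqVneq i j; apply/funext => f; rewrite /av.
under eq_bigr do rewrite mulr_sumr; rewrite exchange_big; apply: eq_bigr => z _.
by rewrite mulr_sumr; apply: eq_bigr => y _; rewrite mulrCA upd_comm.
Qed.

Lemma supported_av i F S : supported F S -> supported (av i F) S.
Proof.
move=> FS f g fg; apply: eq_bigr => y _; congr (_ * _); apply: FS => j jS.
by rewrite /upd; case: ifP => // _; apply: fg.
Qed.

Lemma supported_upd i F S f y : supported F S -> i \notin S -> F (upd f i y) = F f.
Proof. by move=> FS iS; apply: FS => j jS; apply: upd_neq; apply: contraNneq iS => <-. Qed.

Lemma supported_sub F S S' : supported F S -> S \subset S' -> supported F S'.
Proof. by move=> FS /subsetP sub f g fg; apply: FS => i /sub; apply: fg. Qed.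

Lemma avsD s F G f : avs s (fun f => F f + G f) f = avs s F f + avs s G f.
Proof. by elim: s F G => //= i s IH F G; rewrite avD IH. Qed.

Lemma avsZ s a F f : avs s (fun f => a * F f) f = a * avs s F f.
Proof. by elim: s F => //= i s IH F; rewrite avZ IH. Qed.

Lemma avs_le s F G : (forall f, F f <= G f) -> forall f, avs s F f <= avs s G f.
Proof. by elim: s F G => //= i s IH F G FG; apply: IH; apply: av_le. Qed.

Lemma avs_av s i F : avs s (av i F) = av i (avs s F).
Proof. by elim: s F => //= j s IH F; rewrite -IH av_comm. Qed.

Lemma avs_cst s a f : avs s (fun=> a) f = a.
Proof.
elim: s => //= i s IH; rewrite -[RHS]IH; congr (avs s _ f).
by apply/funext => g; rewrite av_const.
Qed.

(** Independence: every coordinate lies outside one of the two disjoint supports, and that factor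
    can be pulled out of the average over it. *)
Lemma avsM s F G S S' f : supported F S -> supported G S' -> [disjoint S & S'] ->
  avs s (fun f => F f * G f) f = avs s F f * avs s G f.
Proof.
move=> + + dis; elim: s F G => //= i s IH F G FS GS.
rewrite -IH; [|exact: supported_av|exact: supported_av].
congr (avs s _ f); apply/funext => g.
have [iS|iS] := boolP (i \in S).
  have Gi h y : G (upd h i y) = G h.
    by apply: supported_upd GS _; rewrite (disjointFr dis).
  rewrite (av_const (F := G)) // mulrC -av_constM //.
  by congr (av i _ g); apply/funext => h; rewrite mulrC.
have Fi h y : F (upd h i y) = F h by apply: supported_upd FS _.
by rewrite (av_const (F := F)) // -av_constM.
Qed.

Lemma expectD F G : expect (fun f => F f + G f) = expect F + expect G.
Proof. exact: avsD. Qed.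

Lemma expectZ a F : expect (fun f => a * F f) = a * expect F.
Proof. exact: avsZ. Qed.

Lemma expect_cst a : expect (fun=> a) = a.
Proof. exact: avs_cst. Qed.

Lemma expectB F G : expect (fun f => F f - G f) = expect F - expect G.
Proof.
rewrite -mulN1r -expectZ -expectD.
by congr expect; apply/funext => f; rewrite mulN1r.
Qed.

Lemma expect_sum (K : Type) (r : seq K) (P : pred K) (F : K -> (I -> T) -> R) :
  expect (fun f => \sum_(k <- r | P k) F k f) = \sum_(k <- r | P k) expect (F k).
Proof.
elim: r => [|k r IH].
  by rewrite big_nil -[RHS](expect_cst 0); congr expect; apply/funext => f; rewrite big_nil.
rewrite big_cons -IH; case: ifP => Pk; last first.
  by congr expect; apply/funext => f; rewrite big_cons Pk.
by rewrite -expectD; congr expect; apply/funext => f; rewrite big_cons Pk.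
Qed.

Lemma expect_le F G : (forall f, F f <= G f) -> expect F <= expect G.
Proof. by move=> FG; apply: avs_le. Qed.

Lemma expect_ge0 F : (forall f, 0 <= F f) -> 0 <= expect F.
Proof. by move=> F0; rewrite -(expect_cst 0); apply: expect_le. Qed.

(** Averages over coordinates commute, and averaging over one coordinate is idempotent. *)
Lemma expect_av i F : expect (av i F) = expect F.
Proof.
suff avsi s : i \in s -> avs s (av i F) = avs s F by rewrite /expect avsi ?mem_enum.
elim: s => //= j s IH; rewrite inE; have [-> _|_ /= /IH avi] := eqVneq i j.
  by congr avs; apply/funext => f; rewrite (@av_const j (av j F)) // => y; rewrite av_upd.
by rewrite !(avs_av s j) avi.
Qed.

(** The law of total expectation, conditioning on coordinate [i]. *)
Lemma expect_upd i F :
  expect F = \sum_y w i y * expect (fun f => F (upd f i y)).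
Proof.
rewrite -(expect_av i) /av expect_sum; apply: eq_bigr => y _.
exact: expectZ.
Qed.

Lemma expect_coord i (h : T -> R) : expect (fun f => h (f i)) = \sum_y w i y * h y.
Proof.
rewrite (expect_upd i); apply: eq_bigr => y _; congr (_ * _).
by rewrite -[RHS]expect_cst; congr expect; apply/funext => f; rewrite upd_eq.
Qed.

Lemma expect_coord_eq i y : expect (fun f => (f i == y)%:R) = w i y.
Proof.
rewrite (expect_coord i (fun z => (z == y)%:R)) (bigD1 y) //= eqxx mulr1 big1 ?addr0 //.
by move=> z /negbTE ->; rewrite mulr0.
Qed.

Lemma expectM F G S S' : supported F S -> supported G S' -> [disjoint S & S'] ->
  expect (fun f => F f * G f) = expect F * expect G.
Proof. exact: avsM. Qed.

Lemma expect_prod (K : finType) (F : K -> (I -> T) -> R) (S : K -> {set I}) :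
  (forall k, supported (F k) (S k)) ->
  (forall k l, k != l -> [disjoint S k & S l]) ->
  expect (fun f => \prod_k F k f) = \prod_k expect (F k).
Proof.
move=> FS dis.
have : uniq (enum K) := enum_uniq K.
under eq_fun do rewrite -big_enum.
rewrite -[RHS]big_enum; elim: (enum K) => [_|k r IH /= /andP[kr ur]].
  by rewrite big_nil -[RHS]expect_cst; congr expect; apply/funext => f; rewrite big_nil.
rewrite big_cons -IH //.
rewrite -(expectM (S := S k) (S' := (\bigcup_(l in r) S l)%SET)) //.
- by congr expect; apply/funext => f; rewrite big_cons.
- move=> f g fg; rewrite big_seq [RHS]big_seq; apply: eq_bigr => l lr.
  by apply: FS => i il; apply: fg; apply/bigcupP; exists l.
- by apply: bigcup_disjoint => l lr; apply: dis; apply: contraNneq kr => ->.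
Qed.

(** The coordinates are fixed one by one, at values that keep the average positive. Positive weights
    later exclude choices of probability 0. *)
Lemma expect_exists_gt0 F : 0 < expect F ->
  exists f, 0 < F f /\ forall i, 0 < w i (f i).
Proof.
suff pos s f : 0 < avs s F f -> exists g, 0 < F g /\ forall i, i \in s -> 0 < w i (g i).
  by move=> /pos[g [Fg wg]]; exists g; split=> // i; apply: wg; rewrite mem_enum.
elim: s F f => [|i s IH] F f /=; first by move=> F0; exists f.
move=> /IH[g [Fg wg]].
have [y Fy] : exists y, 0 < w i y * F (upd g i y).
  apply: contrapT => /forallNP Fle; move: Fg; rewrite ltNge => /negP; apply.
  by apply: sumr_le0 => y _; rewrite leNgt; apply/negP; apply: Fle.
have wy : 0 < w i y.
  by rewrite lt_def w_ge0 andbT; apply: contraTneq Fy => ->; rewrite mul0r ltxx.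
exists (upd g i y); split; first by rewrite -(pmulr_rgt0 _ wy).
move=> j; rewrite inE; have [->|ji] := eqVneq j i; first by rewrite upd_eq.
by rewrite upd_neq //; apply: wg.
Qed.

Lemma supportedM F G S : supported F S -> supported G S ->
  supported (fun f => F f * G f) S.
Proof. by move=> FS GS f g fg; rewrite (FS f g) // (GS f g). Qed.

(** * The symmetric Lovasz local lemma *)

Section LocalLemma.
Variables (V : finType) (b : V -> (I -> T) -> bool) (S : V -> {set I}).
Variables (N : V -> {set V}) (p : R).
Hypothesis b_S : forall v f g, (forall i, i \in S v -> f i = g i) -> b v f = b v g.
Hypothesis S_disj : forall u v, u \notin N v -> [disjoint S v & S u].
Hypothesis b_p : forall v, expect (fun f => (b v f)%:R) <= p.
Hypothesis p_le : p <= 4^-1.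
Hypothesis pN : forall v, 4 * p * #|N v|%:R <= 1.

Let avoid (A : {set V}) f : R := \prod_(u in A) (1 - (b u f)%:R).

Let avoid_ge0 A f : 0 <= avoid A f.
Proof. by apply: prodr_ge0 => u _; case: b; rewrite ?subrr ?subr0. Qed.

Let avoid_le (A B : {set V}) f : B \subset A -> avoid A f <= avoid B f.
Proof.
move=> BA; rewrite /avoid (big_setID B) /= (setIidPr BA) -[leRHS]mulr1.
apply: ler_wpM2l; first exact: avoid_ge0.
by apply: prodr_ile1 => u _; case: b; rewrite ?subrr ?subr0 ?lexx ?ler01.
Qed.

Let p_ge0 (v : V) : 0 <= p.
Proof. by apply: le_trans (b_p v); apply: expect_ge0 => f; apply: ler0n. Qed.

Let avoid_supported (A : {set V}) v : [disjoint A & N v] ->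
  supported (avoid A) (~: S v)%SET.
Proof.
move=> AN f g fg; apply: eq_bigr => u uA; congr (1 - _%:R); congr nat_of_bool.
apply: b_S => i iu; apply: fg; rewrite inE.
by rewrite (disjointFl (S_disj _) iu) // (disjointFr AN).
Qed.

(** The usual induction on the size of [A]: given that the events of [A] are avoided, [b v] has
    probability at most 2p. The events outside [N v] are independent of [b v]; those inside cost at
    most a factor 2. *)
Lemma local_lemma_step n (A : {set V}) v : (#|A| <= n)%N ->
  0 < expect (avoid A) /\
  expect (fun f => (b v f)%:R * avoid A f) <= 2 * p * expect (avoid A).
Proof.
elim: n A v => [|n IH] A v An.
  move: An; rewrite leqn0 cards_eq0 => /eqP ->.
  have -> : avoid set0 = fun=> 1 by apply/funext => f; rewrite /avoid big_set0.
  rewrite expect_cst mulr1; split => //.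
  under [X in expect X]eq_fun do rewrite mulr1.
  by apply: le_trans (b_p v) _; have := p_ge0 v; lra.
have pos (u : V) : u \in A -> 0 < expect (avoid A).
  move=> uA; have Au : (#|A :\ u| <= n)%N.
    by move: An; rewrite (cardsD1 u) uA.
  have [pos le] := IH _ u Au.
  have -> : avoid A = fun f => avoid (A :\ u)%SET f - (b u f)%:R * avoid (A :\ u)%SET f.
    apply/funext => f; rewrite /avoid (big_setD1 u) //=; ring.
  by rewrite expectB; move: p_le; nra.
have {}pos : 0 < expect (avoid A).
  have [->|[u /pos]//] := set_0Vmem A.
  have -> : avoid set0 = fun=> 1 by apply/funext => f; rewrite /avoid big_set0.
  by rewrite expect_cst.
split=> //.
pose A2 := (A :\: N v)%SET.
have EA2 : expect (fun f => (b v f)%:R * avoid A2 f) <= p * expect (avoid A2).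
  rewrite (expectM (S := S v) (S' := (~: S v)%SET)).
  - by apply: ler_wpM2r; [apply: expect_ge0 => f; apply: avoid_ge0|exact: b_p].
  - by move=> f g fg; rewrite (b_S fg).
  - by apply: avoid_supported; rewrite disjoints_subset; apply/subsetP => u; rewrite !inE => /andP[].
  - by rewrite disjoints_subset setCK.
have le1 : expect (fun f => (b v f)%:R * avoid A f) <= expect (fun f => (b v f)%:R * avoid A2 f).
  by apply: expect_le => f; apply: ler_wpM2l; [exact: ler0n|apply: avoid_le; exact: subsetDl].
(* If [A] misses [N v], then [A2] is [A] and independence suffices; otherwise [A2] is smaller and
   the induction hypothesis applies to it. *)
have [AN0|[u0]] := set_0Vmem (A :&: N v)%SET.
  have A2A : A2 = A by apply/eqP; rewrite eqEsubset subsetDl /= subsetD subxx -setI_eq0 AN0 eqxx.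
  by rewrite A2A in EA2; apply: le_trans EA2 _; move: (p_ge0 v); nra.
rewrite inE => /andP[u0A u0N].
have A2n : (#|A2| <= n)%N.
  rewrite -ltnS; apply: leq_trans An; apply: proper_card; rewrite properE subsetDl /=.
  by apply/negP => /subsetP /(_ _ u0A); rewrite inE u0N.
(* Union bound over the events of [A] in [N v]; by induction each takes at most a fraction 2p of the
   mass of [avoid A2], in total at most half. *)
have low : expect (avoid A2) - \sum_(u in A :&: N v) expect (fun f => (b u f)%:R * avoid A2 f)
   <= expect (avoid A).
  rewrite -expect_sum -expectB; apply: expect_le => f.
  have -> : avoid A f = \prod_(u in A :&: N v) (1 - (b u f)%:R) * avoid A2 f.
    by rewrite /avoid (big_setID (N v)).
  rewrite -mulr_suml -[X in X - _]mul1r -mulrBl.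
  apply: ler_wpM2r; first exact: avoid_ge0.
  by apply: weierstrass_prod => u _; case: b; rewrite ?lexx ler01.
have sum_le : \sum_(u in A :&: N v) expect (fun f => (b u f)%:R * avoid A2 f) <= 2^-1 * expect (avoid A2).
  have [pos2 _] := IH _ v A2n.
  apply: (@le_trans _ _ (\sum_(u in A :&: N v) 2 * p * expect (avoid A2))).
    by apply: ler_sum => u _; have [] := IH _ u A2n.
  rewrite sumr_const -[leLHS]mulr_natl mulrA; apply: ler_wpM2r; first exact: ltW.
  have le_N : #|(A :&: N v)%SET|%:R <= #|N v|%:R :> R.
    by rewrite ler_nat subset_leq_card // subsetIr.
  by have := pN v; have := ler_wpM2l (p_ge0 v) le_N; lra.
apply: le_trans le1 (le_trans EA2 _).
have half : 2^-1 * expect (avoid A2) <= expect (avoid A) by lra.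
by have := ler_wpM2l (p_ge0 v) half; lra.
Qed.

Theorem local_lemma : exists f,
  (forall v, ~~ b v f) /\ forall i, 0 < w i (f i).
Proof.
have [v0 _|noV] := pickP V; last first.
  have [f [_ wf]] : exists f, (0 : R) < 1 /\ forall i, 0 < w i (f i).
    by apply: (@expect_exists_gt0 (fun=> 1)); rewrite expect_cst.
  by exists f; split=> // v; have := noV v; rewrite inE.
have [pos _] := local_lemma_step v0 (leqnn #|[set: V]%SET|).
have [f [+ wf]] := expect_exists_gt0 pos.
rewrite /avoid => {}pos; exists f; split=> // v; apply/negP => bv.
by move: pos; rewrite (bigD1 v) ?inE //= bv subrr mul0r ltxx.
Qed.
End LocalLemma.

(** * Exponential moments and concentration *)

Lemma expect_markov (b : (I -> T) -> bool) F : (forall f, b f -> 0 <= F f) ->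
  expect (fun f => (b f)%:R) <= expect (fun f => expR (F f)).
Proof.
move=> bF; apply: expect_le => f; case: (boolP (b f)) => [/bF F0|_].
  by rewrite -expR0 ler_expR.
exact: expR_ge0.
Qed.

(** Jensen's inequality, from the tangent of the exponential at the mean [m]. *)
Lemma expR_av i F f : expR (av i F f) <= av i (fun g => expR (F g)) f.
Proof.
set m := av i F f.
have -> : expR m = \sum_y w i y * (expR m * (1 + (F (upd f i y) - m))).
  under eq_bigr do rewrite mulrCA.
  rewrite -mulr_sumr -[LHS]mulr1; congr (_ * _).
  under eq_bigr do rewrite mulrDr mulr1 mulrBr.
  by rewrite !big_split /= sumrN -mulr_suml w_sum -/(av i F f) -/m; ring.
apply: ler_sum => y _; apply: ler_wpM2l => //.
rewrite -[in leRHS](subrK m (F _)) expRD [leRHS]mulrC.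
by apply: ler_wpM2l; [exact: expR_ge0|exact: expR_ge1Dx].
Qed.

(* The exponential moments of a function on a product space are controlled by
   revealing the coordinates one at a time: averaging a coordinate out only
   improves, by Jensen's inequality, the bounds on the others. *)
Lemma avs_mgf s c (b : I -> R) F f :
  (forall i g, i \in s -> av i (fun h => expR (c * (F h - av i F h))) g <= expR (b i)) ->
  avs s (fun h => expR (c * F h)) f <= expR (c * avs s F f + \sum_(i <- s) b i).
Proof.
elim: s F => [|i s IH] F hb /=; first by rewrite big_nil addr0.
rewrite big_cons addrCA addrC expRD; rewrite mulrC.
apply: (@le_trans _ _ (avs s (fun h => expR (b i) * expR (c * av i F h)) f)).
  apply: avs_le => h.
  have := hb i h (mem_head _ _); rewrite mulrC.
  have -> : av i (fun h => expR (c * F h)) h =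
     expR (c * av i F h) * av i (fun h => expR (c * (F h - av i F h))) h.
    rewrite [in RHS]/av mulr_sumr; apply: eq_bigr => y _.
    by rewrite mulrCA -!/(av i F _) av_upd -expRD; congr (_ * expR _); ring.
  by apply: ler_wpM2l; apply: expR_ge0.
rewrite avsZ; apply: ler_wpM2l; first exact: expR_ge0.
apply: IH => j g js.
apply: (@le_trans _ _ (av j (av i (fun h => expR (c * (F h - av j F h)))) g)).
  apply: av_le => h.
  apply: le_trans (expR_av _ _ _).
  rewrite ler_expR avZ av_comm {2}/av {1}/av -sumrB.
  by under eq_bigr do rewrite -mulrBr.
rewrite av_comm -[leRHS](av_const (i := i) (F := fun=> expR (b j)) (f := g)) //.
by apply: av_le => h; apply: hb; rewrite inE js orbT.
Qed.

Lemma expect_mgf c (b : I -> R) F :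
  (forall i g, av i (fun h => expR (c * (F h - av i F h))) g <= expR (b i)) ->
  expect (fun h => expR (c * F h)) <= expR (c * expect F + \sum_i b i).
Proof. by move=> hb; rewrite -big_enum; apply: avs_mgf. Qed.

(** A Bernstein bound in one coordinate: the exponent is at most 1/2, its linear term averages to 0,
    and the variance is at most the second moment about the value at [t0], which [h] controls. *)
Lemma av_mgf i (c : R) F (h : T -> R) (D B : R) f :
  (forall y, `|F (upd f i y) - F (upd f i t0)| <= h y) -> (forall y, h y <= D) ->
  `|c| * D <= 4^-1 -> \sum_y w i y * h y ^+ 2 <= B ->
  av i (fun g => expR (c * (F g - av i F g))) f <= expR (2 * c ^+ 2 * B).
Proof.
move=> Fh hD cD hB; set m := av i F f; set a := F (upd f i t0).
have D0 : 0 <= D := le_trans (le_trans (normr_ge0 _) (Fh t0)) (hD t0).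
have ma : m - a = \sum_y w i y * (F (upd f i y) - a).
  by under eq_bigr do rewrite mulrBr; rewrite sumrB -mulr_suml w_sum mul1r.
have maD : `|m - a| <= D.
  rewrite ma; apply: le_trans (ler_norm_sum _ _ _) _.
  rewrite -[leRHS]mul1r -(w_sum i) mulr_suml; apply: ler_sum => y _.
  by rewrite normrM ger0_norm //; apply: ler_wpM2l => //; apply: le_trans (Fh y) _.
apply: (@le_trans _ _ (\sum_y w i y * (1 + c * (F (upd f i y) - m) +
   2 * (c * (F (upd f i y) - m)) ^+ 2))).
  apply: ler_sum => y _; apply: ler_wpM2l => //; rewrite av_upd -/m.
  apply: expR_le_quad; apply: le_trans (ler_norm _) _; rewrite normrM.
  apply: (@le_trans _ _ (`|c| * (D + D))); last lra.
  apply: ler_wpM2l => //; have -> : F (upd f i y) - m = (F (upd f i y) - a) - (m - a) by ring.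
  by apply: le_trans (ler_normB _ _) _; apply: lerD => //; apply: le_trans (Fh y) _.
apply: le_trans (expR_ge1Dx _).
have -> : \sum_y w i y * (1 + c * (F (upd f i y) - m) +
   2 * (c * (F (upd f i y) - m)) ^+ 2) =
   1 + 2 * c ^+ 2 * (\sum_y w i y * (F (upd f i y) - a) ^+ 2 - (m - a) ^+ 2).
  (* Expanding around [a] makes the sum a linear combination of the moments 1, [u] and [Q] of
     [F - a]. *)
  set Q := \sum_y w i y * (F (upd f i y) - a) ^+ 2; set u := m - a.
  pose k0 := 1 - c * u + 2 * c ^+ 2 * u ^+ 2; pose k1 := c - 4 * c ^+ 2 * u.
  have -> : 1 + 2 * c ^+ 2 * (Q - u ^+ 2) = 1 * k0 + u * k1 + Q * (2 * c ^+ 2).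
    by rewrite /k0 /k1; ring.
  have -> : 1 * k0 + u * k1 + Q * (2 * c ^+ 2) =
      \sum_y (w i y * k0 + w i y * (F (upd f i y) - a) * k1 +
              w i y * (F (upd f i y) - a) ^+ 2 * (2 * c ^+ 2)).
    by rewrite !big_split /= -!mulr_suml w_sum -ma.
  by apply: eq_bigr => y _; rewrite /k0 /k1 /u; ring.
rewrite lerD2l; apply: ler_wpM2l; first by rewrite mulr_ge0 ?sqr_ge0.
apply: le_trans hB; rewrite lerBlDr; apply: ler_wpDr; first exact: sqr_ge0.
apply: ler_sum => y _; apply: ler_wpM2l => //; rewrite -real_normK ?num_real //.
by rewrite ler_sqr ?nnegrE ?(le_trans (normr_ge0 _) (Fh y)).
Qed.
End ProductSpace.

(** * Independent transversals *)

Lemma big_option (R : nmodType) (T : finType) (F : option T -> R) :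
  \sum_o F o = F None + \sum_x F (Some x).
Proof.
rewrite (bigD1 None) //=; congr (_ + _).
rewrite (reindex_omap (fun x : T => Some x) id) /=; first last.
  by case.
by apply: eq_bigl => x; rewrite eqxx.
Qed.

Section Cover.
Import mathcomp.boot.fintype mathcomp.boot.finset.
Variables (R : realType) (X V : finType) (pi : X -> V) (conf : rel X) (adj : rel V).
Hypothesis conf_sym : symmetric conf.
Hypothesis adj_irr : irreflexive adj.
Hypothesis conf_adj : forall x y, conf x y -> adj (pi x) (pi y).
Implicit Types (A T : {set X}) (x y z : X) (u v : V).

(** [X] is the set of nodes and [pi] gives the vertex of a node; [part A v] is what [A] retains of
    the list of [v]. *)
Definition part A v := [set x in A | pi x == v]%SET.
Definition cdeg A x := #|[set y in A | conf x y]%SET|.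
(** Only the nonempty parts of [A] have to be met. *)
Definition indep_transversal A T :=
  [/\ T \subset A, forall x y, x \in T -> y \in T -> ~~ conf x y
    & forall x, x \in A -> exists2 y, y \in T & pi y = pi x].

(** [None] means that no node of the part is tried. The choice is uniform if [p] is the inverse of
    the part size; the nibble takes 1/(16t). *)
Definition pick_weight (p : R) A v (o : option X) : R :=
  if o is Some x then (if x \in part A v then p else 0)
  else 1 - p * #|part A v|%:R.

Lemma pick_weight_ge0 p A v o : 0 <= p -> p * #|part A v|%:R <= 1 ->
  0 <= pick_weight p A v o.
Proof. by case: o => [x|] /=; [case: ifP | rewrite subr_ge0]. Qed.

Lemma pick_weight_sum p A v (h : option X -> R) :
  \sum_o pick_weight p A v o * h o =
  (1 - p * #|part A v|%:R) * h None + \sum_(x in part A v) p * h (Some x).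
Proof.
rewrite big_option /=; congr (_ + _); rewrite [RHS]big_mkcond /=.
by apply: eq_bigr => x _; case: ifP; rewrite ?mul0r.
Qed.

Lemma pick_weight_sum1 p A v : \sum_o pick_weight p A v o = 1.
Proof.
under eq_bigr do rewrite -[pick_weight _ _ _ _]mulr1.
by rewrite pick_weight_sum sumr_const -[_ *+ #|_|]mulr_natr; ring.
Qed.

Lemma conf_pi_neq x y : conf x y -> pi x != pi y.
Proof. by move=> /conf_adj; apply: contraTneq => ->; rewrite adj_irr. Qed.

(** Conflicts leaving a part are counted as ordered pairs, both for the neighbourhoods in the local
    lemma and for the average degree in a list. *)
Lemma sum_cdeg_part A v : \sum_(x in part A v) cdeg A x =
  #|[set q : X * X | [&& q.1 \in part A v, q.2 \in A & conf q.1 q.2]]%SET|.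
Proof.
rewrite -sum1dep_card.
rewrite (eq_bigl (fun q : X * X => (q.1 \in part A v) && ((q.2 \in A) && conf q.1 q.2))) //.
rewrite -(pair_big_dep (fun x => x \in part A v) (fun x y => (y \in A) && conf x y) (fun _ _ => 1%N)) /=.
by apply: eq_bigr => x _; rewrite sum1dep_card.
Qed.

Lemma sum_cdeg_le A v (l : nat) (t : R) : 0 <= t -> (#|part A v| <= l)%N ->
  (forall x, x \in A -> (cdeg A x)%:R <= t) ->
  (\sum_(x in part A v) cdeg A x)%:R <= l%:R * t.
Proof.
move=> t0 Al At; rewrite natr_sum.
apply: (@le_trans _ _ (\sum_(x in part A v) t)).
  by apply: ler_sum => x; rewrite inE => /andP[/At].
by rewrite sumr_const -[leLHS]mulr_natl ler_wpM2r // ler_nat.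
Qed.

(* The local lemma for a uniform random choice from every part, with one bad
   event for each conflict. *)
Lemma transversal_of_large_parts A (l : nat) (t : R) : (2 <= l)%N -> 0 <= t ->
  (forall x, x \in A -> #|part A (pi x)| = l) ->
  (forall x, x \in A -> (cdeg A x)%:R <= t) -> 16 * t <= l%:R ->
  exists T, indep_transversal A T.
Proof.
move=> l2 t0 Al At tl.
have l0 : (0 : R) < l%:R by rewrite ltr0n (leq_trans _ l2).
pose p : R := l%:R^-1.
have part_l v : part A v = set0 \/ #|part A v| = l.
  have [->|[x]] := set_0Vmem (part A v); first by left.
  by rewrite inE => /andP[/Al + /eqP <-]; right.
have w_ge0 v o : 0 <= pick_weight p A v o.
  apply: pick_weight_ge0; first by rewrite invr_ge0 ltW.
  by have [->|->] := part_l v; rewrite ?cards0 ?mulr0 // /p mulVf // gt_eqF.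
pose w := pick_weight p A.
have w_sum v := pick_weight_sum1 p A v.
pose cpair (q : X * X) := [&& q.1 \in A, q.2 \in A & conf q.1 q.2].
pose b (q : X * X) (f : V -> option X) :=
  cpair q && ((f (pi q.1) == Some q.1) && (f (pi q.2) == Some q.2)).
(* Pairs that are not conflicts get an empty support, which keeps them out of all neighbourhoods. *)
pose S (q : X * X) := if cpair q then [set pi q.1; pi q.2]%SET else set0.
pose N q := [set q' | ~~ [disjoint S q & S q']]%SET.
have [|||||f [bf wf]] := @local_lemma R V (option X) None w w_ge0 w_sum _ b S N (p ^+ 2).
- move=> q f g fg; rewrite /b; case: (boolP (cpair q)) => //= cq.
  by rewrite !fg // /S cq !inE eqxx ?orbT.
- by move=> q q'; rewrite inE negbK.
- move=> q; case: (boolP (cpair q)) => cq; last first.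
    rewrite [X in expect _ _ X](_ : _ = fun=> 0) ?expect_cst ?sqr_ge0 //.
    by apply/funext => f; rewrite /b (negbTE cq).
  have /and3P[q1 q2 q12] := cq.
  rewrite [X in expect _ _ X](_ : _ = fun f => (f (pi q.1) == Some q.1)%:R * (f (pi q.2) == Some q.2)%:R); last first.
    by apply/funext => f; rewrite /b cq /= -natrM mulnb.
  rewrite (@expectM _ _ _ _ _ w_sum _ _ [set pi q.1]%SET [set pi q.2]%SET) //.
  + by rewrite !expect_coord_eq // /w /= !inE q1 q2 !eqxx expr2.
  + by move=> f g fg; rewrite fg ?inE.
  + by move=> f g fg; rewrite fg ?inE.
  + by rewrite disjoints1 inE conf_pi_neq.
- have : p <= 2^-1 by rewrite lef_pV2 ?posrE // ler_nat.
  have : 0 <= p by rewrite invr_ge0 ltW.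
  rewrite expr2; nra.
(* A conflict sharing a vertex with [q] has its first or second node in one of the two parts of [q].
   So four sets of size at most lt cover [N q], and 4 p^2 |N q| <= 16 t / l <= 1. *)
- move=> q; pose E1 u := [set q : X * X | [&& q.1 \in part A u, q.2 \in A & conf q.1 q.2]]%SET.
  pose E2 u := [set (q.2, q.1) | q in E1 u]%SET.
  have E1l u : #|E1 u|%:R <= l%:R * t.
    rewrite -sum_cdeg_part; apply: sum_cdeg_le => //.
    by have [->|->] := part_l u; rewrite ?cards0.
  have E2l u : #|E2 u|%:R <= l%:R * t.
    by apply: le_trans (E1l u); rewrite ler_nat leq_imset_card.
  have NE : N q \subset (E1 (pi q.1) :|: E2 (pi q.1)) :|: (E1 (pi q.2) :|: E2 (pi q.2)).
    apply/subsetP => q'; rewrite inE -setI_eq0 => /set0Pn[u]; rewrite inE /S.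
    case: ifP => cq; last by rewrite inE.
    case: ifP => [/and3P[q1 q2 q12]|_]; last by rewrite !inE andbF.
    have in1 : q' \in E1 (pi q'.1) by rewrite !inE q1 q2 q12 eqxx.
    have in2 : q' \in E2 (pi q'.2).
      by apply/imsetP; exists (q'.2, q'.1); rewrite ?inE /= ?q1 ?q2 ?eqxx 1?conf_sym -?surjective_pairing.
    rewrite !in_set2 !in_setU => /andP[/orP[]/eqP-> /orP[]/eqP->];
      by rewrite ?in1 ?in2 ?orbT.
  have : #|N q|%:R <= 4 * (l%:R * t).
    apply: (@le_trans _ _ (#|E1 (pi q.1)| + #|E2 (pi q.1)| + (#|E1 (pi q.2)| + #|E2 (pi q.2)|))%:R).
      rewrite ler_nat; apply: leq_trans (subset_leq_card NE) _.
      apply: leq_trans (leq_of_leqif (leq_card_setU _ _)) _.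
      by apply: leq_add; apply: leq_of_leqif (leq_card_setU _ _).
    rewrite !natrD; have := E1l (pi q.1); have := E1l (pi q.2).
    have := E2l (pi q.1); have := E2l (pi q.2); lra.
  have pl : p * l%:R = 1 by rewrite /p mulVf // gt_eqF.
  have p0 : 0 <= p by rewrite invr_ge0 ltW.
  move=> Nl; apply: le_trans (ler_wpM2l _ Nl) _; first by rewrite mulr_ge0 ?sqr_ge0.
  have -> : 4 * p ^+ 2 * (4 * (l%:R * t)) = (p * l%:R) * p * (16 * t) by ring.
  rewrite pl mul1r; apply: le_trans (ler_wpM2l p0 tl) _.
  by rewrite pl.
exists [set x in A | f (pi x) == Some x]%SET; split.
- by apply/subsetP => x; rewrite inE => /andP[].
- move=> x y; rewrite !inE => /andP[xA fx] /andP[yA fy]; apply/negP => xy.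
  by have := bf (x, y); rewrite /b /cpair /= xA yA xy fx fy.
(* An outcome of positive weight is not [None] here, since that has weight 1 - pl = 0. *)
- move=> x xA; have := wf (pi x); rewrite /w /pick_weight.
  case fx: (f (pi x)) => [y|]; last first.
    by rewrite (Al x xA) /p mulVf ?subrr ?ltxx // gt_eqF.
  case: ifP => [|_]; last by rewrite ltxx.
  rewrite inE => /andP[yA /eqP yx] _; exists y => //.
  by rewrite inE yA yx fx eqxx.
Qed.
End Cover.

(** * One round of the nibble *)

(** The exponent in [degree_tail]: the mean is at most 15t/16 - l/32, so the deviation l/64
    contributes -sl/64, and the quadratic term 2 s^2 D t = sl/128 takes back half. *)
Lemma degree_exponent (R : realType) (l D t s : R) :
  0 < D -> 0 < t -> s * (256 * D * t) = l ->
  - (s * (15 / 16 * t - l / 64)) +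
    t * (s * (15 / 16 - (16 * t)^-1 * l / 2) + 2 * s ^+ 2 * D) = - (l / 128 * s).
Proof.
move=> D0 t0 sl.
have pt : (16 * t)^-1 * t = 16^-1 by rewrite invfM mulfVK // gt_eqF.
have -> : 2 * s ^+ 2 * D = 2 * s * (s * D) by rewrite expr2 !mulrA.
have sDt : (s * D) * t = l / 256.
  by rewrite -sl; lra.
have -> : t * (s * (15 / 16 - (16 * t)^-1 * l / 2) + 2 * s * (s * D)) =
  s * (15 / 16 * t - (16 * t)^-1 * t * l / 2) + 2 * s * (s * D * t).
  by move: (16 * t)^-1 => q; ring.
rewrite pt sDt; lra.
Qed.

Lemma degree_rate_le (R : realType) (l D t s : R) :
  0 < t -> l <= 16 * t -> s * (256 * D * t) = l -> s * D <= 4^-1.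
Proof. by move=> t0 lt sl; rewrite -(ler_pM2r t0); lra. Qed.

Section Nibble.
Import mathcomp.boot.fintype mathcomp.boot.finset.
Variables (R : realType) (X V : finType) (pi : X -> V) (conf : rel X) (adj : rel V).
Hypothesis conf_sym : symmetric conf.
Hypothesis adj_sym : symmetric adj.
Hypothesis adj_irr : irreflexive adj.
Hypothesis conf_adj : forall x y, conf x y -> adj (pi x) (pi y).
Hypothesis adj_C3 : forall u v w, adj u v -> adj v w -> adj w u -> False.
Hypothesis adj_C4 : forall u v w z, adj u v -> adj v w -> adj w z -> adj z u ->
  u = w \/ v = z.
Variables (A : {set X}) (d D l : nat) (t : R).
Hypothesis adj_deg : forall v, (#|[set u | adj v u]%SET| <= d)%N.
Hypothesis conf_mult : forall x u,
  (#|[set y | conf x y && (pi y == u)]%SET| <= D)%N.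
Hypothesis A_part : forall x, x \in A -> #|part pi A (pi x)| = l.
Hypothesis A_deg : forall x, x \in A -> (cdeg conf A x)%:R <= t.
Hypothesis t_gt0 : 0 < t.
Hypothesis l_t : l%:R <= 16 * t.
Hypothesis D_gt0 : (0 < D)%N.
Hypothesis D_l : (20 * D <= l)%N.

Implicit Types (x y z : X) (u v : V) (o : option X) (f g : V + X -> option X).

(** For a node of [A], the expected number of tried nodes in conflict with it is then at most pt =
    1/16. *)
Let p : R := (16 * t)^-1.
Definition nb y u := [set z in A | conf y z && (pi z == u)]%SET.
Definition unblocked_prob y : R := \prod_u (1 - p * #|nb y u|%:R).
(* Makes the probability of surviving exactly 15/16 on [A]. *)
Definition coin_prob y : R :=
  if y \in A then 15 / 16 / unblocked_prob y else 1.

(* The coordinate [inl v] holds the colour, if any, tried at [v]; the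
   coordinate [inr y] is a coin for the node [y], which comes up heads when
   its value is [Some y]. *)
Definition nibble_weight (i : V + X) o : R :=
  match i with
  | inl v => pick_weight pi p A v o
  | inr y => if o is Some z then (if z == y then coin_prob y else 0)
             else 1 - coin_prob y
  end.

Definition blocked y f :=
  [exists z, [&& z \in A, conf y z & f (inl (pi z)) == Some z]].
Definition kept y f := (f (inr y) == Some y) && ~~ blocked y f.
(** A tried node is used as soon as no node in conflict with it is tried; its coin decides only
    whether it counts as kept. *)
Definition coloured u f :=
  [exists z, [&& z \in part pi A u, f (inl u) == Some z & ~~ blocked z f]].
Definition good y f := kept y f && ~~ coloured (pi y) f.

Let p_gt0 : 0 < p. Proof. by rewrite invr_gt0 mulr_gt0. Qed.
Let pt : p * t = 16^-1. Proof. by rewrite /p invfM mulfVK // gt_eqF. Qed.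
Let pl : p * l%:R <= 1.
Proof. by have := ler_wpM2l (ltW p_gt0) l_t; have := pt; lra. Qed.
Let l_gt0 : (0 : R) < l%:R.
Proof. by rewrite ltr0n; apply: leq_trans D_l; rewrite muln_gt0. Qed.
Let D_lR : 20 * D%:R <= l%:R :> R.
Proof. by rewrite -natrM ler_nat. Qed.

Lemma part_card v : part pi A v = set0 \/ #|part pi A v| = l.
Proof.
have [->|[x]] := set_0Vmem (part pi A v); first by left.
by rewrite inE => /andP[/A_part + /eqP <-]; right.
Qed.

Lemma part_card_le v : (#|part pi A v| <= l)%N.
Proof. by have [->|->] := part_card v; rewrite ?cards0. Qed.

Lemma nb_card y u : (#|nb y u| <= D)%N.
Proof.
apply: leq_trans (conf_mult y u); apply: subset_leq_card; apply/subsetP => z.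
by rewrite !inE => /andP[].
Qed.

Lemma sum_nb y : \sum_u #|nb y u| = cdeg conf A y.
Proof.
rewrite /cdeg -sum1_card (partition_big pi xpredT) //=; apply: eq_bigr => u _.
by rewrite -sum1_card; apply: eq_bigl => z; rewrite !inE andbA.
Qed.

Lemma sum_nb_p y : y \in A -> \sum_u p * #|nb y u|%:R <= 16^-1.
Proof.
move=> yA; rewrite -mulr_sumr -natr_sum sum_nb -pt.
by apply: ler_wpM2l; [exact: ltW|exact: A_deg].
Qed.

Lemma nb_p01 y u : y \in A -> 0 <= p * #|nb y u|%:R <= 1.
Proof.
move=> yA; rewrite mulr_ge0 ?(ltW p_gt0) //=.
apply: (@le_trans _ _ 16^-1); last lra.
apply: le_trans (sum_nb_p yA); rewrite (bigD1 u) //= lerDl.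
by apply: sumr_ge0 => v _; rewrite mulr_ge0 ?(ltW p_gt0).
Qed.

(** By Weierstrass's inequality with total load at most 1/16. The lower bound is what keeps
    [coin_prob] at most 1. *)
Lemma unblocked_prob_bounds y : y \in A -> 15 / 16 <= unblocked_prob y <= 1.
Proof.
move=> yA; apply/andP; split.
  have := @weierstrass_prod R V xpredT (fun u => p * #|nb y u|%:R).
  move/(_ (fun u _ => nb_p01 u yA)); apply: le_trans.
  by have := sum_nb_p yA; lra.
apply: prodr_ile1 => u _; have /andP[] := nb_p01 u yA; lra.
Qed.

Lemma coin_prob_bounds y : y \in A -> 15 / 16 <= coin_prob y <= 1.
Proof.
move=> yA; have /andP[lo hi] := unblocked_prob_bounds yA; rewrite /coin_prob yA.
have pos : 0 < unblocked_prob y by lra.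
by rewrite ler_pdivlMr // ler_pdivrMr //; lra.
Qed.

Lemma coin_prob01 y : 0 <= coin_prob y <= 1.
Proof.
have [/coin_prob_bounds/andP[lo ->]|yA] := boolP (y \in A); first by lra.
by rewrite /coin_prob (negbTE yA) ler01 lexx.
Qed.

Lemma nibble_weight_ge0 i o : 0 <= nibble_weight i o.
Proof.
case: i => [v|y] /=.
  apply: pick_weight_ge0; first exact: ltW.
  apply: le_trans pl; apply: ler_wpM2l; first exact: ltW.
  by rewrite ler_nat part_card_le.
have /andP[q0 q1] := coin_prob01 y.
by case: o => [z|]; [case: ifP | rewrite subr_ge0].
Qed.

Lemma nibble_weight_sum i : \sum_o nibble_weight i o = 1.
Proof.
case: i => [v|y]; first exact: pick_weight_sum1.
rewrite big_option /= (bigD1 y) //= eqxx big1 ?addr0 ?subrK //.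
by move=> z /negbTE ->.
Qed.

Local Notation E := (expect None nibble_weight).
Let E_ge0 := expect_ge0 None nibble_weight_ge0 nibble_weight_sum.
Let E_le := expect_le None nibble_weight_ge0.
Let E_cst := expect_cst None nibble_weight_sum.
Let E_sum := expect_sum None nibble_weight_sum.

(** * Survival probabilities of single nodes *)

Definition hit y u f := [exists z in nb y u, f (inl u) == Some z].

(** At most one node is tried at [u], so the probabilities of its nodes add up exactly. *)
Lemma E_hit y u : E (fun f => (hit y u f)%:R) = p * #|nb y u|%:R.
Proof.
rewrite (expect_coord None nibble_weight_sum (inl u)
  (fun o => [exists z in nb y u, o == Some z]%:R)) /= pick_weight_sum.
rewrite [X in _ * (nat_of_bool X)%:R + _](_ : _ = false); last first.
  by apply/negbTE/existsP => -[z /andP[]].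
rewrite mulr0 add0r -sum1_card natr_sum mulr_sumr [RHS]big_mkcond [LHS]big_mkcond /=.
apply: eq_bigr => z _; rewrite !inE.
have -> : [exists z0 in nb y u, Some z == Some z0] = (z \in nb y u).
  apply/existsP/idP => [[z0 /andP[z0nb /eqP[->]]]//|znb].
  by exists z; rewrite znb eqxx.
rewrite inE; case: (z \in A) => //=; case: eqP => _; rewrite ?andbF //= andbT.
by case: (conf y z); rewrite ?mulr0.
Qed.

Lemma unblockedE y f : (~~ blocked y f)%:R = \prod_u (1 - (hit y u f)%:R) :> R.
Proof.
case: (boolP (blocked y f)) => [/existsP[z /and3P[zA yz fz]]|nb0] /=.
  rewrite (bigD1 (pi z)) //= (_ : hit y (pi z) f) ?subrr ?mul0r //.
  by apply/existsP; exists z; rewrite fz !inE zA yz eqxx.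
rewrite big1 // => u _; rewrite (_ : hit y u f = false) ?subr0 //.
apply/negbTE; apply: contra nb0 => /existsP[z /andP[]].
rewrite !inE => /and3P[zA yz /eqP <-] fz.
by apply/existsP; exists z; rewrite zA yz fz.
Qed.

Lemma E_unblocked y : E (fun f => (~~ blocked y f)%:R) = unblocked_prob y.
Proof.
under [X in expect _ _ X]eq_fun do rewrite unblockedE.
rewrite (@expect_prod _ _ _ _ _ nibble_weight_sum _ _ (fun u => [set inl u]%SET)).
- apply: eq_bigr => u _.
  by rewrite expectB E_cst E_hit.
- by move=> u f g fg; rewrite /hit fg ?inE.
- by move=> u v uv; rewrite disjoints1 inE.
Qed.

(** This and the next three lemmas locate the coordinates behind each event, as needed for
    independence and for the local lemma. *)
Lemma blocked_eq y f g : (forall w, adj (pi y) w -> f (inl w) = g (inl w)) ->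
  blocked y f = blocked y g.
Proof.
move=> fg; apply: eq_existsb => z; have [yz|] := boolP (conf y z); last by rewrite andbF.
by rewrite fg ?conf_adj.
Qed.

Lemma coloured_eq u f g : f (inl u) = g (inl u) ->
  (forall w, adj u w -> f (inl w) = g (inl w)) -> coloured u f = coloured u g.
Proof.
move=> fgu fg; apply: eq_existsb => z; rewrite fgu; have [|//] := boolP (z \in part pi A u).
by rewrite inE => /andP[_ /eqP zu]; rewrite (@blocked_eq z f g) // zu.
Qed.

Lemma kept_eq y f g : f (inr y) = g (inr y) ->
  (forall w, adj (pi y) w -> f (inl w) = g (inl w)) -> kept y f = kept y g.
Proof. by move=> fgy fg; rewrite /kept fgy (@blocked_eq y f g). Qed.

Lemma good_eq y f g : f (inr y) = g (inr y) -> f (inl (pi y)) = g (inl (pi y)) ->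
  (forall w, adj (pi y) w -> f (inl w) = g (inl w)) -> good y f = good y g.
Proof.
by move=> fgy fgu fg; rewrite /good (@kept_eq y f g) // (@coloured_eq _ f g).
Qed.

Let picks (P : pred V) : {set V + X} := [set i | if i is inl w then P w else false]%SET.

Lemma blocked_supported y :
  supported (fun f => (~~ blocked y f)%:R : R) (picks (adj (pi y))).
Proof.
by move=> f g fg; rewrite (@blocked_eq y f g) // => w aw; apply: fg; rewrite inE.
Qed.

Lemma E_coin y : E (fun f => (f (inr y) == Some y)%:R) = coin_prob y.
Proof. by rewrite (expect_coord_eq _ nibble_weight_sum) /= eqxx. Qed.

Lemma E_kept y : y \in A -> E (fun f => (kept y f)%:R) = 15 / 16.
Proof.
move=> yA; under [X in expect _ _ X]eq_fun do rewrite /kept -mulnb natrM.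
rewrite (@expectM _ _ _ _ _ nibble_weight_sum _ _ [set inr y]%SET (picks (adj (pi y)))).
- rewrite E_coin E_unblocked /coin_prob yA divfK // gt_eqF //.
  by have /andP[] := unblocked_prob_bounds yA; lra.
- by move=> f g fg; rewrite fg ?inE.
- exact: blocked_supported.
- by rewrite disjoints1 inE.
Qed.

Lemma E_blocked y : y \in A -> E (fun f => (blocked y f)%:R) <= 16^-1.
Proof.
move=> yA; have -> : (fun f => (blocked y f)%:R) = (fun f => 1 - (~~ blocked y f)%:R) :> (_ -> R).
  by apply/funext => f; case: blocked; rewrite ?subr0 ?subrr.
rewrite expectB E_cst E_unblocked.
by have /andP[] := unblocked_prob_bounds yA; lra.
Qed.

(** * A node under a fixed choice at another vertex *)

Section Conditional.
Variables (v : V) (o : option X).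
Local Notation cond f := (upd f (inl v) o).

Let spoiled y := [exists z in nb y v, o == Some z].

Lemma blocked_upd y f : ~~ spoiled y -> blocked y (cond f) -> blocked y f.
Proof.
move=> ns /existsP[z /and3P[zA yz]]; have [zv|zv] := eqVneq (pi z) v.
  rewrite zv upd_eq => oz; case/negP: ns; apply/existsP; exists z.
  by rewrite !inE zA yz zv eqxx.
rewrite upd_neq; last by apply: contra_neq zv => -[].
by move=> fz; apply/existsP; exists z; rewrite zA yz.
Qed.

(** Forcing the choice at [v] can unblock [y] only if [y] was hit from [v]. *)
Lemma unblocked_upd y f :
  (~~ blocked y (cond f))%:R <= (~~ blocked y f)%:R + (hit y v f)%:R :> R.
Proof.
have [/existsP[z /and3P[zA yz fz]]|_] := boolP (blocked y f); last first.
  by case: blocked; case: hit => /=; lra.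
have [|no_hit] := boolP (hit y v f); first by case: blocked => /=; lra.
rewrite (_ : blocked y (cond f)) /=; first by lra.
apply/existsP; exists z; rewrite zA yz /= upd_neq //.
apply: contra no_hit => /eqP[zv]; apply/existsP; exists z.
by rewrite !inE zA yz zv eqxx -zv.
Qed.

Lemma spoiled_card u : (#|[set z in part pi A u | spoiled z]%SET| <= D)%N.
Proof.
rewrite /spoiled; case: o => [z0|]; last first.
  rewrite (_ : [set _ in _ | _]%SET = set0) ?cards0 //; apply/setP => z.
  by rewrite !inE; apply/negP => /andP[_ /existsP[z' /andP[]]].
apply: leq_trans (conf_mult z0 u); apply: subset_leq_card; apply/subsetP => z.
rewrite !inE => /andP[/andP[_ ->] /existsP[z' /andP[]]].
by rewrite !inE => /and3P[_ zz' _] /eqP[->]; rewrite conf_sym zz'.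
Qed.

Lemma blocked_cond_supported y :
  supported (fun f => (~~ blocked y (cond f))%:R : R) (picks (adj (pi y))).
Proof.
move=> f g fg; rewrite (@blocked_eq y (cond f) (cond g)) // => w aw.
by rewrite /upd; case: ifP => // _; apply: fg; rewrite inE.
Qed.

(** A spoiled [y] cannot be good. Otherwise it is kept with probability at most 15/16 + pD, and each
    of the at least l - D unspoiled nodes at its vertex colours that vertex, with [y] kept, with
    probability at least (15/16)(7/8)p. As 20 D <= l, a gain of pl/2 remains. *)
Lemma E_good y : y \in A -> v != pi y ->
  E (fun f => (good y (cond f))%:R) <= 15 / 16 - p * l%:R / 2.
Proof.
move=> yA vy; set u := pi y.
have upd_inl w f : w != v -> (cond f) (inl w) = f (inl w).
  by move=> wv; rewrite upd_neq //; apply: contra wv => /eqP[->].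
have [sp|nsp] := boolP (spoiled y).
  have -> : (fun f => (good y (cond f))%:R) = (fun=> 0) :> (_ -> R).
    apply/funext => f; rewrite /good /kept (_ : blocked y (cond f)) ?andbF //.
    have /existsP[z /andP[]] := sp; rewrite !inE => /and3P[zA yz /eqP zv] oz.
    by apply/existsP; exists z; rewrite zA yz zv upd_eq.
  by rewrite E_cst; have := pl; lra.
(* [F z] indicates that [y] is kept and that [z] is tried at [u] and unblocked, so that [u] is
   coloured. Different [z] exclude each other. *)
pose F z f : R := (f (inr y) == Some y)%:R * ((f (inl u) == Some z)%:R *
  ((~~ blocked y (cond f))%:R * (~~ blocked z (cond f))%:R)).
pose Z := [set z in part pi A u | ~~ spoiled z]%SET.
have split f : (good y (cond f))%:R <=
  (f (inr y) == Some y)%:R * (~~ blocked y (cond f))%:R - \sum_(z in Z) F z f.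
  pose B := kept y (cond f) && coloured u (cond f).
  have F_le z : z \in Z -> F z f <= B%:R * (f (inl u) == Some z)%:R.
    rewrite inE => /andP[zAu nsz]; rewrite /F /B /kept /coloured -!natrM !mulnb ler_nat.
    rewrite (_ : (cond f) (inr y) = f (inr y)) //.
    have [fz|] := eqVneq (f (inl u)) (Some z); last by rewrite !andbF.
    case: (f (inr y) == Some y) => //=.
    case: (blocked y (cond f)) => //=; have [//|ubz] := boolP (blocked z (cond f)).
    rewrite (_ : [exists _, _]) //; apply/existsP; exists z.
    by rewrite zAu upd_inl 1?eq_sym // fz eqxx ubz.
  have sumF : \sum_(z in Z) F z f <= B%:R.
    apply: (@le_trans _ _ (\sum_(z in Z) B%:R * (f (inl u) == Some z)%:R)).
      exact: ler_sum.
    rewrite -mulr_sumr -[leRHS]mulr1; apply: ler_wpM2l => //.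
    case: (f (inl u)) => [z0|]; last by rewrite big1.
    apply: (@le_trans _ _ (\sum_z (Some z0 == Some z)%:R)).
      by rewrite [leRHS](bigID (mem Z)) /= lerDl; apply: sumr_ge0 => z _.
    rewrite (bigD1 z0) //= eqxx big1 ?addr0 // => z zz0.
    by rewrite (_ : (Some z0 == Some z) = false) //; apply: contra_neqF zz0 => /eqP[].
  have -> : (f (inr y) == Some y)%:R * (~~ blocked y (cond f))%:R =
     (kept y (cond f))%:R :> R by rewrite -natrM mulnb.
  have -> : (good y (cond f))%:R = (kept y (cond f))%:R - B%:R :> R.
    rewrite /good /B -/u; case: kept; case: coloured; rewrite ?subrr ?subr0 //=.
  lra.
apply: le_trans (E_le split) _; rewrite expectB E_sum.
have /andP[q_lo q_hi] := coin_prob_bounds yA.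
have first_le : E (fun f => (f (inr y) == Some y)%:R * (~~ blocked y (cond f))%:R)
   <= 15 / 16 + p * D%:R.
  rewrite (@expectM _ _ _ _ _ nibble_weight_sum _ _ [set inr y]%SET (picks (adj u))).
  - rewrite E_coin.
    have le1 : E (fun f => (~~ blocked y (cond f))%:R) <= unblocked_prob y + p * D%:R.
      apply: le_trans (E_le (unblocked_upd y)) _.
      rewrite expectD E_unblocked E_hit lerD2l; apply: ler_wpM2l; first exact: ltW.
      by rewrite ler_nat nb_card.
    have -> : 15 / 16 = coin_prob y * unblocked_prob y.
      rewrite /coin_prob yA divfK // gt_eqF //.
      by have /andP[] := unblocked_prob_bounds yA; lra.
    apply: le_trans (ler_wpM2l _ le1) _; first lra.
    rewrite mulrDr lerD2l -[leRHS]mul1r ler_wpM2r //.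
    by rewrite mulr_ge0 // ltW.
  - by move=> f g fg; rewrite fg ?inE.
  - exact: blocked_cond_supported.
  - by rewrite disjoints1 inE.
(* The coin of [y], the pick at [u] and the other picks are independent; [y] and [z] are both
   unblocked with probability at least 1 - 1/16 - 1/16 = 7/8. *)
have F_ge z : z \in Z -> 15 / 16 * (p * (7 / 8)) <= E (F z).
  rewrite inE => /andP[zAu nsz]; have := zAu; rewrite inE => /andP[zA /eqP zu].
  have sup_y : supported (fun f => (~~ blocked y (cond f))%:R * (~~ blocked z (cond f))%:R : R)
      (picks (fun w => w != u)).
    have sub : picks (adj u) \subset picks (fun w => w != u).
      apply/subsetP => i; rewrite !inE; case: i => // w.
      by apply: contraTneq => ->; rewrite adj_irr.
    apply: supportedM; apply: supported_sub sub; first exact: blocked_cond_supported.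
    by rewrite -zu; apply: blocked_cond_supported.
  rewrite (@expectM _ _ _ _ _ nibble_weight_sum _ _ [set inr y]%SET (picks xpredT)).
  - rewrite (@expectM _ _ _ _ _ nibble_weight_sum _ _ [set inl u]%SET (picks (fun w => w != u))) //.
    + rewrite E_coin (expect_coord_eq _ nibble_weight_sum) /= zAu.
      apply: ler_pM => //; first by rewrite mulr_ge0 ?ltW //; lra.
      apply: ler_wpM2l; first exact: ltW.
      apply: (@le_trans _ _ (E (fun f => 1 - (blocked y f)%:R - (blocked z f)%:R))).
        by rewrite !expectB E_cst; have := E_blocked yA; have := E_blocked zA; lra.
      apply: E_le => f; have := @blocked_upd y f nsp; have := @blocked_upd z f nsz.
      case: (blocked y (cond f)) => [_ /(_ isT) ->|/[swap] _].
        by rewrite mul0r subrr sub0r oppr_le0.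
      case: (blocked z (cond f)) => [/(_ isT) ->|_]; first by rewrite mulr0 lerBlDr add0r gerBl.
      by rewrite mulr1 -addrA gerDl -opprD oppr_le0 addr_ge0.
    + by move=> f g fg; rewrite fg ?inE.
    + by rewrite disjoints1 inE negbK.
  - by move=> f g fg; rewrite fg ?inE.
  - apply: supportedM; first by move=> f g fg; rewrite fg ?inE.
    by apply: supported_sub sup_y _; apply/subsetP => i; rewrite !inE; case: i.
  - by rewrite disjoints1 inE.
have Z_card : l%:R - D%:R <= #|Z|%:R :> R.
  rewrite lerBlDl -natrD ler_nat -(A_part yA) -/u.
  apply: (@leq_trans #|[set z in part pi A u | spoiled z]%SET :|: Z|).
    by apply: subset_leq_card; apply/subsetP => z; rewrite /Z !inE => ->; case: spoiled.
  apply: leq_trans (leq_of_leqif (leq_card_setU _ _)) _.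
  by rewrite leq_add2r spoiled_card.
have sum_ge : #|Z|%:R * (15 / 16 * (p * (7 / 8))) <= \sum_(z in Z) E (F z).
  by rewrite mulr_natl -sumr_const; apply: ler_sum => z /F_ge.
have pD := ler_wpM2l (ltW p_gt0) Z_card.
have pDl := ler_wpM2l (ltW p_gt0) D_lR.
apply: le_trans (lerB first_le sum_ge) _.
have pD0 : 0 <= p * D%:R by rewrite mulr_ge0 // ltW.
lra.
Qed.
End Conditional.

(** * Upper tail of the degrees *)

Definition good_degree x f : R := \sum_(y in A | conf x y) (good y f)%:R.

Section DegreeTail.
Variables (x : X) (o : option X).
Hypothesis xA : x \in A.
Local Notation cond f := (upd f (inl (pi x)) o).
Let mean : R := 15 / 16 - p * l%:R / 2.
Let share u f : R := \sum_(y in nb x u) (good y (cond f))%:R.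

Let mean01 : 0 <= mean <= 1.
Proof.
have := pl; have : 0 <= p * l%:R by rewrite mulr_ge0 // ltW.
by rewrite /mean; lra.
Qed.

Let share_sum f : good_degree x (cond f) = \sum_u share u f.
Proof.
rewrite /good_degree (partition_big pi xpredT) //=; apply: eq_bigr => u _.
by apply: eq_bigl => y; rewrite !inE andbA.
Qed.

Let share_le u f : 0 <= share u f <= #|nb x u|%:R.
Proof.
rewrite sumr_ge0 //= -sum1_card natr_sum; apply: ler_sum => y _.
by rewrite lern1 leq_b1.
Qed.

Let E_share u : E (share u) <= #|nb x u|%:R * mean.
Proof.
rewrite E_sum mulr_natl -sumr_const; apply: ler_sum => y.
rewrite inE => /and3P[yA xy _]; apply: E_good => //.
exact: conf_pi_neq adj_irr conf_adj _ _ xy.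
Qed.

(** Nodes at the same vertex may depend strongly on each other, so only the range is used: the share
    is at most [D], hence its square at most [D] times itself. *)
Lemma E_exp_share (s : R) u : 0 <= s -> s * D%:R <= 2^-1 ->
  E (fun f => expR (s * share u f)) <=
  expR (#|nb x u|%:R * (s * mean + 2 * s ^+ 2 * D%:R)).
Proof.
move=> s0 sD.
have step f : expR (s * share u f) <= 1 + (s + 2 * s ^+ 2 * D%:R) * share u f.
  have /andP[Y0 Yn] := share_le u f.
  have YD : share u f <= D%:R by apply: le_trans Yn _; rewrite ler_nat nb_card.
  apply: le_trans (expR_le_quad _) _; first exact: le_trans (ler_wpM2l s0 YD) sD.
  have : s ^+ 2 * (share u f * share u f) <= s ^+ 2 * (D%:R * share u f).
    by apply: ler_wpM2l; [exact: sqr_ge0|exact: ler_wpM2r].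
  rewrite exprMn [share u f ^+ 2]expr2; lra.
apply: le_trans (E_le step) _; rewrite expectD expectZ E_cst.
apply: le_trans (expR_ge1Dx _); rewrite lerD2l.
have s2 : 0 <= s ^+ 2 * D%:R by rewrite mulr_ge0 // sqr_ge0.
apply: le_trans (ler_wpM2l _ (E_share u)) _; first lra.
have /andP[m0 m1] := mean01.
have -> : (s + 2 * s ^+ 2 * D%:R) * (#|nb x u|%:R * mean) =
  #|nb x u|%:R * (s * mean + 2 * (s ^+ 2 * D%:R * mean)) by ring.
apply: ler_wpM2l => //; rewrite lerD2l.
by have := ler_wpM2l s2 m1; lra.
Qed.

(* Once the choice at [pi x] is fixed, the contributions of the different
   neighbours of [pi x] depend on disjoint sets of coordinates, because there
   are no cycles of length 3 or 4. *)
Lemma E_exp_degree (s : R) : 0 <= s -> s * D%:R <= 2^-1 ->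
  E (fun f => expR (s * good_degree x (cond f))) <=
  expR (t * (s * mean + 2 * s ^+ 2 * D%:R)).
Proof.
move=> s0 sD; under [X in expect _ _ X]eq_fun do rewrite share_sum mulr_sumr expR_sum.
pose block u : {set V + X} := if adj (pi x) u then
  [set i | match i with inl w => (w != pi x) && ((w == u) || adj u w)
                      | inr y => pi y == u end]%SET else set0.
rewrite (@expect_prod _ _ _ _ _ nibble_weight_sum _ _ block).
- apply: (@le_trans _ _ (\prod_u expR (#|nb x u|%:R * (s * mean + 2 * s ^+ 2 * D%:R)))).
    apply: ler_prod => u _; rewrite E_exp_share // andbT.
    by apply: E_ge0 => f; apply: expR_ge0.
  rewrite -expR_sum -mulr_suml -natr_sum sum_nb ler_expR.
  apply: ler_wpM2r; last exact: A_deg.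
  have /andP[m0 m1] := mean01.
  by rewrite addr_ge0 // mulr_ge0 // mulr_ge0 // sqr_ge0.
- move=> u f g fg; congr expR; congr (_ * _).
  apply: eq_bigr => y; rewrite inE => /and3P[yA xy /eqP yu].
  have xu : adj (pi x) u by rewrite -yu conf_adj.
  rewrite /block xu in fg.
  have fgi w : (w == u) || adj u w -> (cond f) (inl w) = (cond g) (inl w).
    move=> wu; rewrite /upd; case: ifP => // /negbT wx.
    by apply: fg; rewrite inE wu andbT; apply: contra wx => /eqP ->.
  rewrite (@good_eq y (cond f) (cond g)) //.
  + by rewrite /upd /=; apply: fg; rewrite inE yu.
  + by apply: fgi; rewrite yu eqxx.
  + by move=> w aw; apply: fgi; rewrite -yu aw orbT.
- move=> u u' uu'; rewrite -setI_eq0 /block.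
  case: ifP => [xu|_]; last by rewrite set0I eqxx.
  case: ifP => [xu'|_]; last by rewrite setI0 eqxx.
  apply/eqP/setP => i; rewrite !inE; case: i => [w|y]; last first.
    by apply/negP => /andP[/eqP ->]; rewrite (negbTE uu').
  apply/negP => /andP[/andP[wx wu] /andP[_ wu']].
  case/orP: wu => [/eqP wu|uw]; case/orP: wu' => [/eqP wu'|u'w].
  + by rewrite -wu -wu' eqxx in uu'.
  + by rewrite wu in u'w; apply: (adj_C3 xu' u'w); rewrite adj_sym.
  + by rewrite wu' in uw; apply: (adj_C3 xu uw); rewrite adj_sym.
  + rewrite adj_sym in u'w; rewrite adj_sym in xu'.
    have [xw|e] := adj_C4 xu uw u'w xu'.
      by rewrite xw eqxx in wx.
    by rewrite e eqxx in uu'.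
Qed.

End DegreeTail.

Lemma degree_tail x : x \in A ->
  E (fun f => (15 / 16 * t - l%:R / 64 < good_degree x f)%R%:R) <=
  expR (- (l%:R / 128 * (l%:R / (256 * D%:R * t)))).
Proof.
move=> xA; set a := 15 / 16 * t - l%:R / 64; set B := expR _.
have D0 : (0 : R) < D%:R by rewrite ltr0n.
(* This [s] minimises the exponent 2 s^2 D t - s l / 64. *)
pose s : R := l%:R / (256 * D%:R * t).
have u_gt0 : 0 < 256 * D%:R * t := mulr_gt0 (mulr_gt0 (ltr0Sn _ 255) D0) t_gt0.
have s0 : 0 <= s := divr_ge0 (ltW l_gt0) (ltW u_gt0).
have s_def : s * (256 * D%:R * t) = l%:R := divfK (lt0r_neq0 u_gt0) _.
have sD_le : s * D%:R <= 2^-1 by have := degree_rate_le t_gt0 l_t s_def; lra.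
rewrite (expect_upd None nibble_weight_sum (inl (pi x))).
have -> : B = \sum_o nibble_weight (inl (pi x)) o * B.
  by rewrite -mulr_suml nibble_weight_sum mul1r.
apply: ler_sum => o _.
apply: ler_wpM2l; first exact: nibble_weight_ge0.
apply: le_trans (expect_markov None nibble_weight_ge0 (F := fun f => s * (good_degree x (upd f (inl (pi x)) o) - a)) _) _.
  by move=> f /ltW af; rewrite mulr_ge0 // subr_ge0.
rewrite (_ : (fun f => _) = (fun f => expR (- (s * a)) * expR (s * good_degree x (upd f (inl (pi x)) o)))); last first.
  by apply/funext => f; rewrite -expRD; congr expR; ring.
rewrite expectZ; apply: le_trans (ler_wpM2l _ (E_exp_degree _ xA s0 sD_le)) _; first exact: expR_ge0.
by rewrite -expRD ler_expR degree_exponent.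
Qed.


(** * Lower tail of the list sizes *)

Section ListTail.
Variables (v : V) (delta : R).
Hypothesis v_part : #|part pi A v| = l.
Hypothesis delta01 : 0 < delta <= 1.

(** At a vertex that stays uncoloured the kept nodes are exactly the good ones. *)
Definition kept_card f : R := \sum_(y in part pi A v) (kept y f)%:R.

Let load z : nat := #|[set y in part pi A v | conf z y]%SET|.

Let load_le z : (load z <= D)%N.
Proof.
apply: leq_trans (conf_mult z v); apply: subset_leq_card; apply/subsetP => y.
by rewrite !inE => /andP[/andP[_ ->] ->].
Qed.

Lemma E_kept_card : E kept_card = 15 / 16 * l%:R.
Proof.
rewrite E_sum -v_part mulr_natr -sumr_const; apply: eq_bigr => y.
by rewrite inE => /andP[yA _]; apply: E_kept.
Qed.

(* Trying [z] at [u] can only affect the nodes in conflict with [z]. *)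
Lemma kept_card_pick u f o :
  `|kept_card (upd f (inl u) o) - kept_card (upd f (inl u) None)| <=
  (if o is Some z then (load z)%:R else 0).
Proof.
case: o => [z|]; last by rewrite subrr normr0.
rewrite /kept_card -sumrB; apply: le_trans (ler_norm_sum _ _ _) _.
rewrite /load -sum1_card natr_sum [leLHS]big_mkcond [leRHS]big_mkcond /=.
apply: ler_sum => y _; rewrite !inE; case: ((y \in A) && _) => //=; have [zy|nzy] := boolP (conf z y).
  by case: kept; case: kept; rewrite ?subrr ?subr0 ?sub0r ?normrN ?normr0 ?normr1.
rewrite (_ : kept y _ = kept y (upd f (inl u) None)) ?subrr ?normr0 //.
rewrite /kept; congr (_ && ~~ _); apply: eq_existsb => z'.
rewrite /upd; case: ifP => // _; have [/andP[] |] := boolP ((z' \in A) && conf y z').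
  move=> -> yz' /=; rewrite yz' /=; apply/eqP => -[zz']; case/negP: nzy.
  by rewrite conf_sym zz'.
by rewrite !andbA => /negbTE ->.
Qed.

Lemma kept_card_coin y f o :
  `|kept_card (upd f (inr y) o) - kept_card (upd f (inr y) None)| <=
  (y \in part pi A v)%:R.
Proof.
rewrite /kept_card -sumrB; apply: le_trans (ler_norm_sum _ _ _) _.
rewrite big_mkcond (bigD1 y) //= big1 ?addr0; last first.
  move=> y' y'y; case: ifP => // _; rewrite (@kept_eq y' _ (upd f (inr y) None)) ?subrr ?normr0 //.
  by rewrite !upd_neq //; apply: contra_neq y'y => -[].
case: ifP => // _.
by case: kept; case: kept; rewrite ?subrr ?subr0 ?sub0r ?normrN ?normr0 ?normr1.
Qed.

(** Bounds the variance due to the picks: each load is at most [D], and by double counting the loads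
    add up to the degrees in the part of [v], at most lt; finally pt = 1/16. *)
Lemma sum_load : \sum_u \sum_(z in part pi A u) p * (load z)%:R ^+ 2 <= D%:R * l%:R / 16.
Proof.
apply: (@le_trans _ _ (\sum_u \sum_(z in part pi A u) p * D%:R * (load z)%:R)).
  apply: ler_sum => u _; apply: ler_sum => z _; rewrite -mulrA.
  apply: ler_wpM2l; first exact: ltW.
  by rewrite expr2; apply: ler_wpM2r; rewrite ?ler_nat.
have -> : \sum_u \sum_(z in part pi A u) p * D%:R * (load z)%:R =
  p * D%:R * \sum_(z in A) (load z)%:R.
  rewrite mulr_sumr [RHS](partition_big pi xpredT) //=; apply: eq_bigr => u _.
  by apply: eq_bigl => z; rewrite inE.
have -> : \sum_(z in A) (load z)%:R = (\sum_(y in part pi A v) cdeg conf A y)%:R :> R.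
  rewrite -natr_sum; congr _%:R.
  under eq_bigr do rewrite /load -sum1_card.
  under [RHS]eq_bigr do rewrite /cdeg -sum1_card.
  rewrite (exchange_big_dep (fun y => y \in part pi A v)) /=; last first.
    by move=> z y _; rewrite inE => /andP[].
  apply: eq_bigr => y yv; apply: eq_bigl => z; rewrite inE yv inE conf_sym.
  by [].
have le_lt := sum_cdeg_le (ltW t_gt0) (part_card_le v) A_deg.
have pD0 : 0 <= p * D%:R by rewrite mulr_ge0 // ltW.
apply: le_trans (ler_wpM2l pD0 le_lt) _.
have -> : p * D%:R * (l%:R * t) = p * t * (D%:R * l%:R) by ring.
by rewrite pt mulrC.
Qed.

(** The constant is 17/8 = 2 (1 + 1/16): the coins contribute variance at most l <= D l and the
    picks at most D l / 16. *)
Lemma E_exp_kept_card (s : R) : 0 <= s -> s * D%:R <= 4^-1 ->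
  E (fun f => expR (- s * kept_card f)) <=
  expR (- s * (15 / 16 * l%:R) + 17 / 8 * s ^+ 2 * D%:R * l%:R).
Proof.
move=> s0 sD.
pose b (i : V + X) : R := 2 * (- s) ^+ 2 * match i with
  | inl u => \sum_(z in part pi A u) p * (load z)%:R ^+ 2
  | inr y => (y \in part pi A v)%:R end.
apply: le_trans (expect_mgf None nibble_weight_ge0 nibble_weight_sum (b := b) _) _.
  move=> [u|y] g.
    apply: (av_mgf nibble_weight_ge0 nibble_weight_sum (D := D%:R)
      (kept_card_pick u g)) => [[z|]||] //.
    - by rewrite ler_nat load_le.
    - by rewrite normrN ger0_norm.
    - by rewrite pick_weight_sum expr0n mulr0 add0r.
  apply: (av_mgf nibble_weight_ge0 nibble_weight_sum (D := D%:R)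
      (kept_card_coin y g)) => //.
  - by move=> _; rewrite ler_nat; apply: leq_trans (leq_b1 _) _.
  - by rewrite normrN ger0_norm.
  - rewrite -mulr_suml nibble_weight_sum mul1r.
    by case: (y \in _); rewrite ?expr1n ?expr0n.
rewrite E_kept_card ler_expR lerD2l /b -mulr_sumr big_sumType /=.
have D1 : (1 : R) <= D%:R by rewrite ler1n.
have -> : \sum_(y : X) (y \in part pi A v)%:R = l%:R :> R.
  by rewrite -natr_sum -v_part -sum1_card [in RHS]big_mkcond.
rewrite sqrrN; have -> : 17 / 8 * s ^+ 2 * D%:R * l%:R = 2 * s ^+ 2 * (17 / 16 * (D%:R * l%:R)) by field.
apply: ler_wpM2l; first by rewrite mulr_ge0 // sqr_ge0.
have := ler_wpM2r (ltW l_gt0) D1; have := sum_load; lra.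
Qed.

Lemma list_tail : E (fun f => (kept_card f < (15 / 16 - delta) * l%:R)%R%:R) <=
  expR (- (delta ^+ 2 * l%:R / (10 * D%:R))).
Proof.
have /andP[d0 d1] := delta01.
have D0 : (0 : R) < D%:R by rewrite ltr0n.
(* The quadratic term is then 17/40 of the gain s delta l, so more than half of the gain remains. *)
pose s : R := delta / (5 * D%:R).
have s_def : s * (5 * D%:R) = delta by rewrite divfK // mulf_neq0 // gt_eqF.
have s0 : 0 <= s by rewrite divr_ge0 // ltW // mulr_gt0.
have sD_le : s * D%:R <= 4^-1 by lra.
apply: le_trans (expect_markov None nibble_weight_ge0
  (F := fun f => s * ((15 / 16 - delta) * l%:R - kept_card f)) _) _.
  by move=> f /ltW ?; rewrite mulr_ge0 // subr_ge0.
rewrite (_ : (fun f => _) = (fun f => expR (s * ((15 / 16 - delta) * l%:R)) *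
   expR (- s * kept_card f))); last first.
  by apply/funext => f; rewrite -expRD; congr expR; ring.
rewrite expectZ; apply: le_trans (ler_wpM2l (expR_ge0 _) (E_exp_kept_card s0 sD_le)) _.
rewrite -expRD ler_expR.
have -> : delta ^+ 2 * l%:R / (10 * D%:R) = s * delta * l%:R / 2.
  by rewrite -s_def; field; rewrite gt_eqF.
have -> : 17 / 8 * s ^+ 2 * D%:R * l%:R = 17 / 40 * (s * delta * l%:R).
  by rewrite -s_def; field.
have : 0 <= s * delta * l%:R by rewrite !mulr_ge0 // ltW.
lra.
Qed.
End ListTail.

(** * The local lemma for one round *)

Let near u : {set V} := [set w | (w == u) || adj u w]%SET.
(** The ball of radius 2 holds all coordinates of the bad event at [u]: good nodes at a neighbour of
    [u] depend on the picks at the neighbours of that neighbour. *)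
Let near2 u : {set V} := (\bigcup_(w in near u) near w)%SET.

Let near_refl u : u \in near u.
Proof. by rewrite inE eqxx. Qed.

Let near_adj u w : adj u w -> w \in near u.
Proof. by rewrite inE orbC => ->. Qed.

Let near_sym u w : (w \in near u) = (u \in near w).
Proof. by rewrite !inE eq_sym adj_sym. Qed.

Let near2_sym u w : w \in near2 u -> u \in near2 w.
Proof.
move=> /bigcupP[z zu wz]; apply/bigcupP; exists z; first by rewrite near_sym.
by rewrite near_sym.
Qed.

Let card_near u : (#|near u| <= d.+1)%N.
Proof.
have -> : near u = u |: [set w | adj u w]%SET by apply/setP => w; rewrite !inE.
by rewrite cardsU1; apply: leq_add (leq_b1 _) (adj_deg u).
Qed.

Let card_bigcup_le (B : {set V}) (F : V -> {set V}) m n : (#|B| <= m)%N ->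
  (forall u, (#|F u| <= n)%N) -> (#|\bigcup_(u in B) F u| <= m * n)%N.
Proof.
move=> Bm Fn; apply: (@leq_trans (\sum_(u in B) n)); last first.
  by rewrite sum_nat_const leq_mul2r Bm orbT.
elim/big_rec2: _ => [|u k C _ Ck]; first by rewrite cards0.
by apply: leq_trans (leq_of_leqif (leq_card_setU _ _)) _; apply: leq_add.
Qed.

Let card_near2 u : (#|near2 u| <= d.+1 ^ 2)%N.
Proof. by rewrite -mulnn; apply: card_bigcup_le. Qed.

(** The bad event at [v] is that its list loses too much or one of its nodes keeps too large a
    degree; [q] bounds it by the union bound. Events interact only when their balls of radius 2
    meet, which allows at most (d+1)^4 neighbours. [T] gathers the nodes chosen in this round, [A']
    those passed on. *)
Lemma nibble_step (delta : R) : 0 < delta <= 1 ->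
  4 * (d.+1%:R ^+ 4) * (expR (- (delta ^+ 2 * l%:R / (10 * D%:R))) +
     l%:R * expR (- (l%:R / 128 * (l%:R / (256 * D%:R * t))))) <= 1 ->
  exists A' T : {set X},
    [/\ A' \subset A, T \subset A /\ (forall x y, x \in T -> y \in T -> ~~ conf x y),
      forall x y, x \in A' -> y \in T -> ~~ conf x y,
      forall x, x \in A -> (exists2 y, y \in T & pi y = pi x) \/
        (15 / 16 - delta) * l%:R <= #|part pi A' (pi x)|%:R
    & forall x, x \in A' -> (15 / 16 - delta) * l%:R <= #|part pi A' (pi x)|%:R /\
        (cdeg conf A' x)%:R <= 15 / 16 * t - l%:R / 64].
Proof.
move=> delta01; set q := (_ + _ : R) => q_le.
pose a : R := 15 / 16 * t - l%:R / 64.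
pose b v f := (part pi A v != set0) && ((kept_card v f < (15 / 16 - delta) * l%:R) ||
  [exists x in part pi A v, a < good_degree x f]).
pose loc (i : V + X) := match i with inl w => w | inr y => pi y end.
pose S v := [set i | loc i \in near2 v]%SET.
pose N v := [set u | ~~ [disjoint near2 v & near2 u]]%SET.
have q_ge0 : 0 <= q by rewrite addr_ge0 ?mulr_ge0 ?expR_ge0.
have cardN v : (#|N v| <= d.+1 ^ 4)%N.
  apply: (@leq_trans #|\bigcup_(w in near2 v) near2 w|).
    apply: subset_leq_card; apply/subsetP => u; rewrite inE -setI_eq0 => /set0Pn[w].
    rewrite inE => /andP[wv wu]; apply/bigcupP; exists w => //.
    exact: near2_sym.
  have -> : (d.+1 ^ 4 = d.+1 ^ 2 * d.+1 ^ 2)%N by rewrite -expnD.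
  exact: card_bigcup_le.
have pN v : 4 * q * #|N v|%:R <= 1.
  apply: le_trans q_le; rewrite [leRHS]mulrAC; apply: ler_wpM2l.
    by rewrite mulr_ge0.
  by rewrite -natrX ler_nat.
have [||||f [bf _]] := @local_lemma R _ _ None _ nibble_weight_ge0 nibble_weight_sum
    V b S N q _ _ _ _ pN.
- move=> v f g fg; rewrite /b; case: (part pi A v != set0) => //=.
  have kfg y : pi y \in near v -> kept y f = kept y g.
    move=> yv; apply: kept_eq => [|w aw]; apply: fg; rewrite inE /loc.
      by apply/bigcupP; exists (pi y).
    by apply/bigcupP; exists (pi y); last exact: near_adj.
  have gfg y : pi y \in near v -> good y f = good y g.
    move=> yv; apply: good_eq => [||w aw]; apply: fg; rewrite inE /loc;
      by apply/bigcupP; exists (pi y); last by [|exact: near_adj].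
  congr (_ || _).
    rewrite /kept_card; under eq_bigr => y yv.
      rewrite kfg; last by move: yv; rewrite !inE => /andP[_ /eqP ->]; rewrite eqxx.
      over.
    by [].
  apply: eq_existsb => x; have [|//] := boolP (x \in part pi A v); rewrite inE => /andP[xA /eqP xv] /=.
  rewrite /good_degree; under eq_bigr => y /andP[yA xy].
    rewrite gfg; last by rewrite !inE -xv conf_adj ?orbT.
    over.
  by [].
- move=> u v; rewrite inE negbK => dis; rewrite -setI_eq0; apply/eqP/setP => i.
  by rewrite !inE; apply/negP => /andP[]; move: dis => /disjointFr dis /dis ->.
- move=> v; have [v0|vn0] := eqVneq (part pi A v) set0.
    apply: le_trans q_ge0; rewrite (_ : (fun f => _) = fun=> 0) ?E_cst //.
    by apply/funext => f; rewrite /b v0 eqxx.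
  have vl : #|part pi A v| = l by have [e|//] := part_card v; rewrite e eqxx in vn0.
  apply: le_trans (E_le (G := fun f => (kept_card v f < (15 / 16 - delta) * l%:R)%R%:R +
     \sum_(x in part pi A v) (a < good_degree x f)%R%:R) _) _.
    move=> f; rewrite /b vn0 /=; have [|_] /= := boolP (_ < _).
      by rewrite lerDl sumr_ge0.
    rewrite add0r; case: existsP => [[x /andP[xv ax]]|_] /=.
      by rewrite (bigD1 x) //= ax lerDl sumr_ge0.
    exact: sumr_ge0.
  rewrite expectD E_sum; apply: lerD; first exact: list_tail.
  rewrite -vl mulr_natl -sumr_const; apply: ler_sum => x; rewrite inE => /andP[xA _].
  by rewrite vl; apply: degree_tail.
- have : 4 * 1 * q <= 1.
    apply: le_trans q_le; apply: ler_wpM2r => //; apply: ler_wpM2l => //.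
    by rewrite -natrX ler1n expn_gt0.
  lra.
pose A' := [set y in A | good y f]%SET.
have A'_part x : x \in A -> ~~ coloured (pi x) f ->
    (15 / 16 - delta) * l%:R <= #|part pi A' (pi x)|%:R.
  move=> xA nc; have := bf (pi x); rewrite /b negb_and negbK => /orP[/eqP e|].
    by have : x \in part pi A (pi x); [rewrite inE xA eqxx|rewrite e inE].
  rewrite negb_or -leNgt => /andP[le _]; apply: le_trans le _.
  rewrite /kept_card -sum1_card natr_sum [leLHS]big_mkcond [leRHS]big_mkcond /=.
  apply: ler_sum => y _; rewrite !inE; case: (y \in A) => //=.
  by have [yx|_] := eqVneq (pi y) (pi x); rewrite ?andbF // andbT /good yx nc andbT; case: kept.
exists A', [set z in A | (f (inl (pi z)) == Some z) && ~~ blocked z f]%SET.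
split.
- by apply/subsetP => y; rewrite inE => /andP[].
- split=> [|x y]; first by apply/subsetP => y; rewrite inE => /andP[].
  rewrite !inE => /and3P[xA fx nx] /and3P[yA fy ny]; apply: contra nx => xy.
  by apply/existsP; exists y; rewrite yA xy.
- move=> x y; rewrite !inE => /and3P[xA /andP[_ nx] _] /and3P[yA fy ny].
  by apply: contra nx => xy; apply/existsP; exists y; rewrite yA xy.
- move=> x xA; have [/existsP[z /and3P[]]|nc] := boolP (coloured (pi x) f).
    rewrite inE => /andP[zA /eqP zx] fz nz; left; exists z => //.
    by rewrite inE zA zx fz nz.
  by right; apply: A'_part.
- move=> x; rewrite inE => /andP[xA gx]; split.
    by apply: A'_part => //; case/andP: gx.
  have := bf (pi x).
  have xx : x \in part pi A (pi x) by rewrite inE xA eqxx.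
  rewrite /b (_ : part _ _ _ != set0) /=; last by apply/set0Pn; exists x.
  rewrite negb_or => /andP[_] /existsPn /(_ x); rewrite xx /= -leNgt; apply: le_trans.
  rewrite /cdeg /good_degree -sum1_card natr_sum [leLHS]big_mkcond [leRHS]big_mkcond /=.
  apply: ler_sum => y _; rewrite !inE; case: (y \in A) => //=; case: (conf x y); rewrite ?andbF //= andbT.
  by case: good.
Qed.

End Nibble.

(** * Iterating the nibble *)

(** Both tails are at most exp(-18L): the first as l >= 1000 D L^3, the second also as t <= Ll/625.
    The neighbourhoods cost a factor of order exp(4L), which leaves 128 exp(-14L). *)
Lemma nibble_failure_le (R : realType) (L d D l t : R) :
  16 <= L -> 0 <= d -> d <= expR L -> 1 <= D -> 1000 * (D * L ^+ 3) <= l ->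
  l <= expR L -> 0 < t -> t <= L / 625 * l ->
  4 * ((1 + d) ^+ 4) * (expR (- (L^-1 ^+ 2 * l / (10 * D))) +
     l * expR (- (l / 128 * (l / (256 * D * t))))) <= 1.
Proof.
move=> L16 d0 dL D1 Dl lL t0 tl.
have L0 : 0 < L by lra.
have D0 : 0 < D by lra.
have L3 : 0 < L ^+ 3 by rewrite exprn_gt0.
have DL3 : 0 < D * L ^+ 3 := mulr_gt0 D0 L3.
have DL2 : 0 < D * L ^+ 2 := mulr_gt0 D0 (exprn_gt0 2 L0).
have DL2_3 : 16 * (D * L ^+ 2) <= D * L ^+ 3.
  by rewrite [L ^+ 3]exprS [D * (L * _)]mulrCA; apply: ler_wpM2r => //; apply: ltW.
have l0 : 0 < l by move: Dl; lra.
have eL1 : 1 <= expR L by rewrite -expR0 ler_expR ltW.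
have e1 : expR (- (L^-1 ^+ 2 * l / (10 * D))) <= expR (- (18 * L)).
  rewrite ler_expR lerN2 ler_pdivlMr; last exact: (mulr_gt0 (ltr0Sn _ 9) D0).
  rewrite exprVn [_^-1 * l]mulrC ler_pdivlMr; last exact: exprn_gt0.
  apply: le_trans Dl; rewrite [L ^+ 3]exprS; move: DL3; rewrite [L ^+ 3]exprS; lra.
have e2 : l * expR (- (l / 128 * (l / (256 * D * t)))) <= expR (- (18 * L)).
  have -> : - (18 * L) = L + - (19 * L) by ring.
  rewrite expRD; apply: ler_pM; [exact: ltW|exact: expR_ge0|exact: lL|].
  rewrite ler_expR lerN2 [l / 128 * _]mulrA ler_pdivlMr; last first.
    exact: (mulr_gt0 (mulr_gt0 (ltr0Sn _ 255) D0) t0).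
  have h1 := ler_wpM2l (ltW (mulr_gt0 L0 D0)) tl.
  have h2 : 16000 * (D * L ^+ 2) * l <= l * l.
    by apply: ler_wpM2r; [exact: ltW | move: Dl DL2_3; lra].
  move: h1 h2; rewrite expr2; have : 0 <= D * (L * L) * l.
    by rewrite mulr_ge0 ?mulr_ge0 // ltW.
  lra.
have s0 : 0 <= expR (- (L^-1 ^+ 2 * l / (10 * D))) +
   l * expR (- (l / 128 * (l / (256 * D * t)))).
  by apply: addr_ge0; [exact: expR_ge0|apply: mulr_ge0; [exact: ltW|exact: expR_ge0]].
apply: (@le_trans _ _ (4 * ((2 * expR L) ^+ 4) * (2 * expR (- (18 * L))))).
  apply: ler_pM => //.
  - by rewrite mulr_ge0 // exprn_ge0 // addr_ge0.
  - rewrite ler_pM2l // lerXn2r ?nnegrE ?addr_ge0 ?mulr_ge0 ?expR_ge0 //; lra.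
  - move: e1 e2; set E1 := expR _; set E2 := l * _; lra.
have -> : 4 * (2 * expR L) ^+ 4 * (2 * expR (- (18 * L))) = 128 * expR (- (14 * L)).
  have -> : - (14 * L) = 4%:R * L + - (18 * L) by ring.
  rewrite expRD expRM_natl; move: (expR L) (expR _) => a b; ring.
rewrite expRN ler_pdivrMr ?expR_gt0 // mul1r.
apply: le_trans (expR_ge1Dx _); move: L16; lra.
Qed.

Lemma round_bounds (R : realType) (delta l t : R) : 0 < delta -> delta <= 16^-1 -> 0 < l -> l < 16 * t ->
  [/\ 7 / 8 <= 15 / 16 - delta, 15 / 16 - delta <= 1, delta <= 1
    & 0 <= 15 / 16 * t - l / 64].
Proof. by move=> *; split; lra. Qed.

(* [c + 1/128] and [c] bound the ratio of degrees to list sizes before and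
   after one nibble. *)
Lemma ratio_step (R : realType) (L c delta l m t : R) : 0 < l -> L * delta = 1 -> 0 < delta <= 16^-1 ->
  t <= L / 625 * l -> t <= (c + 128^-1) * l -> 0 <= c ->
  (15 / 16 - delta) * l <= m -> 15 / 16 * t - l / 64 <= c * m.
Proof.
move=> l0 Ld /andP[d0 d1] tL tc c0 lm.
apply: le_trans (ler_wpM2l c0 lm).
(* The loss from [delta] is at most delta t <= l/625; the gain l/64 covers it together with the step
   of 1/128. *)
have dt := ler_wpM2l (ltW d0) tL.
have dL : delta * (L / 625 * l) = (L * delta) * l / 625 by ring.
rewrite dL Ld in dt.
have r0 : 0 <= 15 / 16 - delta by lra.
have rt := ler_wpM2l r0 tc.
have dl : 0 <= delta * l by rewrite mulr_ge0 // ltW.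
lra.
Qed.

(** * Making all parts equally large *)

Section Trim.
Import mathcomp.boot.fintype mathcomp.boot.finset.

(** Keeps the first [m] nodes of every part. Degrees only drop, and the next round requires parts of
    equal size. *)
Lemma trim_parts (X V : finType) (pi : X -> V) (A : {set X}) (m : nat) : (0 < m)%N ->
  (forall x, x \in A -> (m <= #|part pi A (pi x)|)%N) ->
  exists B : {set X}, [/\ B \subset A, forall x, x \in B -> #|part pi B (pi x)| = m
    & forall x, x \in A -> exists2 y, y \in B & pi y = pi x].
Proof.
move=> m0 Am.
pose B := [set x in A | (index x (enum (part pi A (pi x))) < m)%N]%SET.
have Bpart x : x \in A -> #|part pi B (pi x)| = m.
  move=> xA; have -> : part pi B (pi x) = [set y in take m (enum (part pi A (pi x)))]%SET.
    apply/setP => y; rewrite !inE; have [yA|yA] /= := boolP (y \in A); last first.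
      by apply/esym/negP => /mem_take; rewrite mem_enum inE (negbTE yA).
    have [yx|yx] := eqVneq (pi y) (pi x); last first.
      by rewrite andbF; apply/esym/negP => /mem_take; rewrite mem_enum inE (negbTE yx) andbF.
    by rewrite andbT yx in_take // mem_enum inE yA yx eqxx.
  rewrite cardsE; have /card_uniqP -> : uniq (take m (enum (part pi A (pi x)))).
    exact: take_uniq (enum_uniq _).
  by rewrite size_takel // -cardE Am.
exists B; split.
- by apply/subsetP => x; rewrite inE => /andP[].
- by move=> x; rewrite inE => /andP[xA _]; apply: Bpart.
- move=> x xA; have : (0 < #|part pi B (pi x)|)%N by rewrite Bpart.
  by case/card_gt0P => y; rewrite inE => /andP[yB /eqP yx]; exists y.
Qed.
End Trim.

(** * Induction on the number of rounds *)

Section Iteration.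
Import mathcomp.boot.fintype mathcomp.boot.finset.
Variables (R : realType) (X V : finType) (pi : X -> V) (conf : rel X) (adj : rel V).
Hypothesis conf_sym : symmetric conf.
Hypothesis adj_sym : symmetric adj.
Hypothesis adj_irr : irreflexive adj.
Hypothesis conf_adj : forall x y, conf x y -> adj (pi x) (pi y).
Hypothesis adj_C3 : forall u v w, adj u v -> adj v w -> adj w u -> False.
Hypothesis adj_C4 : forall u v w z, adj u v -> adj v w -> adj w z -> adj z u ->
  u = w \/ v = z.
Variables (d D : nat) (L : R).
Hypothesis adj_deg : forall v, (#|[set u | adj v u]%SET| <= d)%N.
Hypothesis conf_mult : forall x u,
  (#|[set y | conf x y && (pi y == u)]%SET| <= D)%N.
Hypothesis D_gt0 : (0 < D)%N.
Hypothesis L_ge : 16 <= L.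
Hypothesis d_L : d%:R <= expR L.

Lemma cdeg_mono (A B : {set X}) x : B \subset A -> (cdeg conf B x <= cdeg conf A x)%N.
Proof.
move=> /subsetP BA; apply: subset_leq_card; apply/subsetP => y.
by rewrite !inE => /andP[/BA -> ->].
Qed.

Lemma parts_large (n l : nat) : 1000 * (D%:R * L ^+ 3) <= l%:R * (7 / 8) ^+ n ->
  [/\ (2 <= l)%N, (20 * D <= l)%N & 1000 * (D%:R * L ^+ 3) <= l%:R].
Proof.
move=> lB; have D1 : (1 : R) <= D%:R by rewrite ler1n.
have Dl3 : 1000 * (D%:R * L ^+ 3) <= l%:R.
  apply: le_trans lB _; rewrite -[leRHS]mulr1; apply: ler_wpM2l => //.
  by apply: exprn_ile1; lra.
have L1 : 1 <= L ^+ 3 by apply: exprn_ege1; move: L_ge; lra.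
have DL : D%:R <= D%:R * L ^+ 3 :> R by rewrite -[leLHS]mulr1; apply: ler_wpM2l.
split=> //; first by rewrite -(ler_nat R); move: D1 DL Dl3; lra.
by rewrite -(ler_nat R) natrM; move: D1 DL Dl3; lra.
Qed.

(** [n] rounds are left: each lowers the ratio t / l by 1/128 and keeps at least 7/8 of the lists,
    so after them the ratio is at most 1/16 and the local lemma finishes. The factor (7/8)^n
    reserves the losses still to come. *)
Lemma iterate_nibble n (A : {set X}) (l : nat) (t : R) :
  (forall x, x \in A -> #|part pi A (pi x)| = l) ->
  (forall x, x \in A -> (cdeg conf A x)%:R <= t) -> 0 <= t ->
  t <= (16^-1 + n%:R / 128) * l%:R -> t <= L / 625 * l%:R ->
  1000 * (D%:R * L ^+ 3) <= l%:R * (7 / 8) ^+ n -> l%:R <= expR L ->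
  exists T, indep_transversal pi conf A T.
Proof.
elim: n A l t => [|n IH] A l t Al At t0 tn tL lB lL.
  have [l2 _ _] := parts_large lB.
  apply: (@transversal_of_large_parts R _ _ pi conf adj conf_sym adj_irr conf_adj A l t) => //.
  by move: tn; lra.
have [l2 Dl Dl3] := parts_large lB.
have l0 : (0 : R) < l%:R by rewrite ltr0n (leq_trans _ l2).
have [tl|lt] := leP (16 * t) l%:R.
  exact: (@transversal_of_large_parts R _ _ pi conf adj conf_sym adj_irr conf_adj A l t).
have t_gt0 : 0 < t.
  by rewrite -(pmulr_rgt0 _ (ltr0Sn R 15)); apply: lt_trans lt.
have L0 : 0 < L by apply: lt_le_trans L_ge.
(* Small enough that delta t <= l/625, yet large enough for concentration, as l >= 1000 D L^3. *)
pose delta : R := L^-1.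
have Ld : L * delta = 1 by rewrite mulfV // gt_eqF.
have delta0 : 0 < delta by rewrite invr_gt0.
have delta_le : delta <= 16^-1 by rewrite lef_pV2 ?posrE.
have [rate_ge rate_le delta1 t'_ge0] := round_bounds delta0 delta_le l0 lt.
have delta01 : 0 < delta <= 1 by rewrite delta0.
have tn' : t <= (16^-1 + n%:R / 128 + 128^-1) * l%:R.
  have n1 : n.+1%:R = n%:R + 1 :> R by rewrite natr1.
  by move: tn; rewrite n1 [(n%:R + 1) / _]mulrDl mul1r addrA.
(* The bound t <= Ll/625 is preserved as well: a weakened form of it lets [ratio_step] apply with c
   = L/625. *)
have tL' : t <= (L / 625 + 128^-1) * l%:R.
  by rewrite mulrDl; apply: ler_wpDr tL; rewrite mulr_ge0 // invr_ge0.
have D1 : (1 : R) <= D%:R by rewrite ler1n.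
have fail : 4 * d.+1%:R ^+ 4 * (expR (- (delta ^+ 2 * l%:R / (10 * D%:R))) +
    l%:R * expR (- (l%:R / 128 * (l%:R / (256 * D%:R * t))))) <= 1.
  have -> : d.+1%:R = 1 + d%:R :> R by rewrite -add1n natrD.
  exact: nibble_failure_le.
have [A1 [T1 [A1A [T1A T1ind] A1T1 A1cover A1P]]] :=
  nibble_step conf_sym adj_sym adj_irr conf_adj adj_C3 adj_C4 adj_deg conf_mult
    Al At t_gt0 (ltW lt) D_gt0 Dl delta01 fail.
pose big m := (15 / 16 - delta) * l%:R <= m%:R.
have big_l : exists m, big m.
  by exists l; rewrite /big -[leRHS]mul1r; apply: ler_wpM2r rate_le; exact: ltW.
have [m bigm minm] := ex_minnP big_l.
have m_l : (m <= l)%N.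
  by apply: minm; rewrite /big -[leRHS]mul1r; apply: ler_wpM2r rate_le; exact: ltW.
have m78 : l%:R * (7 / 8) <= m%:R :> R.
  by apply: le_trans bigm; rewrite mulrC; apply: ler_wpM2r rate_ge; exact: ltW.
have m0 : (0 < m)%N.
  by rewrite -(ltr0n R); apply: lt_le_trans m78; rewrite mulr_gt0.
have [A2 [A2A1 A2m A2cover]] := trim_parts m0 (fun x xA => minm _ (A1P x xA).1).
have [|||||||T2 [T2A T2ind T2cover]] := IH A2 m (15 / 16 * t - l%:R / 64).
- exact: A2m.
- move=> x xA2; have xA1 := subsetP A2A1 _ xA2.
  apply: le_trans (A1P x xA1).2; rewrite ler_nat; exact: cdeg_mono.
- exact: t'_ge0.
- apply: (ratio_step l0 Ld _ tL tn' _ bigm); first by rewrite delta0.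
  by rewrite addr_ge0 ?divr_ge0 // invr_ge0.
- apply: (ratio_step l0 Ld _ tL tL' _ bigm); first by rewrite delta0.
  exact: divr_ge0 (ltW L0) (ler0n _ 625).
- apply: le_trans lB _; rewrite exprS mulrA; exact: ler_wpM2r.
- by apply: le_trans lL; rewrite ler_nat.
exists (T1 :|: T2)%SET; split.
- by rewrite subUset T1A (subset_trans T2A) // (subset_trans A2A1).
- move=> x y; have T2A1 := subset_trans T2A A2A1.
  rewrite !in_setU => /orP[xT|xT] /orP[yT|yT].
  + exact: T1ind.
  + by rewrite conf_sym; apply: A1T1 => //; apply: (subsetP T2A1).
  + by apply: A1T1 => //; apply: (subsetP T2A1).
  + exact: T2ind.
(* A part missed by [T1] stays nonempty in [A1], hence meets [A2], and is therefore met by [T2]. *)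
- move=> x xA; have [[y yT yx]|x_big] := A1cover x xA.
    by exists y => //; rewrite in_setU yT.
  have : (0 < #|part pi A1 (pi x)|)%N.
    by apply: leq_trans m0 (minm _ x_big).
  case/card_gt0P => y; rewrite inE => /andP[yA1 /eqP <-].
  have [z zA2 <-] := A2cover y yA1; have [w wT <-] := T2cover z zA2.
  by exists w => //; rewrite in_setU wT orbT.
Qed.
End Iteration.

(** * Multigraphs *)

Lemma pow4_le_expR (R : realType) (L : R) : 20 ^+ 5 * 1000 <= L ->
  1000 * L ^+ 4 <= expR (L / 4).
Proof.
set K : R := 20 ^+ 5; have K0 : 0 < K by rewrite exprn_gt0.
have k0 : (0 : R) < 1000 := ltr0Sn _ 999.
move=> KL; have L0 : 0 < L by apply: lt_le_trans KL; apply: mulr_gt0.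
have -> : L / 4 = 5%:R * (L / 20) by field.
(* Since exp(L/20) >= L/20, its fifth power exceeds 1000 L^4 once L >= 20^5 * 1000. *)
rewrite expRM_natl; apply: (@le_trans _ _ ((L / 20) ^+ 5)); last first.
  rewrite lerXn2r ?nnegrE ?expR_ge0 ?divr_ge0 //; first exact: ltW.
  by apply: le_trans (expR_ge1Dx _); rewrite lerDr.
rewrite exprMn exprVn -/K ler_pdivlMr // [L ^+ 5]exprS mulrAC.
by apply: ler_wpM2r; [rewrite exprn_ge0 // ltW | rewrite mulrC].
Qed.

(** As exp(-1/7) <= 7/8, it suffices that N/7 <= L/20; L >= 16 absorbs the rounding of [N]. *)
Lemma pow78_ge (R : realType) (L : R) (N : nat) : 16 <= L -> N%:R <= 128 * L / 625 + 1 ->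
  expR (- (L / 20)) <= (7 / 8) ^+ N.
Proof.
move=> L16 NL; have e78 : expR (- 7^-1) <= 7 / 8 :> R.
  rewrite expRN; have := expR_ge1Dx (7^-1 : R) => h.
  by rewrite -(ler_pM2r (expR_gt0 7^-1)) mulVf ?gt_eqF ?expR_gt0 //; lra.
apply: (@le_trans _ _ (expR (- 7^-1) ^+ N)); last first.
  by rewrite lerXn2r ?nnegrE ?expR_ge0 //; lra.
by rewrite -expRM_natl ler_expR; lra.
Qed.

Lemma large_lists (R : realType) (L D l : R) (N : nat) : 20 ^+ 5 * 1000 <= L -> 16 <= L ->
  0 <= l -> 625 * expR L <= l ^+ 2 * L -> D <= expR (L / 5) ->
  N%:R <= 128 * L / 625 + 1 -> 1000 * (D * L ^+ 3) <= l * (7 / 8) ^+ N.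
Proof.
move=> /pow4_le_expR L4 L16 l0 lL DL /(pow78_ge L16) pN.
have L0 : 0 < L by lra.
have lL2 : expR (L / 2) <= l * L.
  rewrite -ler_sqr ?nnegrE ?expR_ge0 ?mulr_ge0 //; last exact: ltW.
  rewrite -expRM_natl (_ : 2%:R * (L / 2) = L); last by field.
  rewrite exprMn [L ^+ 2]expr2 mulrA; have := expR_ge0 L.
  by have := ler_wpM2r (ltW L0) lL; nra.
rewrite -(ler_pM2r L0).
have -> : 1000 * (D * L ^+ 3) * L = D * (1000 * L ^+ 4) by rewrite [L ^+ 4]exprSr; ring.
have -> : l * (7 / 8) ^+ N * L = l * L * (7 / 8) ^+ N by rewrite mulrAC.
apply: (@le_trans _ _ (expR (L / 5) * expR (L / 4))).
  apply: (@le_trans _ _ (expR (L / 5) * (1000 * L ^+ 4))).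
    apply: ler_wpM2r DL; exact: mulr_ge0 (ler0n _ 1000) (exprn_ge0 4 (ltW L0)).
  by apply: ler_wpM2l L4; apply: expR_ge0.
apply: (@le_trans _ _ (expR (L / 2) * expR (- (L / 20)))).
  by rewrite -!expRD ler_expR; lra.
by apply: ler_pM => //; apply: expR_ge0.
Qed.

(** Choosing a related element for each [x] is injective. This serves to charge nodes, pairs of
    nodes and neighbours to edges. *)
Lemma card_le_rel (T U : finType) (A : {pred T}) (B : {pred U}) (r : T -> U -> bool) :
  (forall x, x \in A -> exists2 y, y \in B & r x y) ->
  (forall x x' y, r x y -> r x' y -> x = x') -> (#|A| <= #|B|)%N.
Proof.
move=> rAB r_inj; pose f x := [pick y in B | r x y].
have fP x : x \in A -> exists y, [/\ y \in B, r x y & f x = Some y].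
  move=> /rAB[y yB rxy]; rewrite /f; case: pickP => [y' /andP[y'B rxy']|/(_ y)].
    by exists y'.
  by rewrite yB rxy.
rewrite -(card_in_imset (f := f)); last first.
  move=> x x' /fP[y [_ rxy ->]] /fP[y' [_ rxy' ->]] [yy'].
  by apply: r_inj rxy _; rewrite yy'.
have SomeU_inj : injective (@Some U) by move=> ? ? [].
rewrite -(card_imset B SomeU_inj); apply: subset_leq_card.
apply/fintype.subsetP => _ /imsetP[x /fP[y [yB _ ->]] ->].
exact: imset_f.
Qed.

(** * Choosing finitely many colours from each list *)

Section Counting.
Import mathcomp.finmap.finmap.

(** A list may be infinite, and then has finite subsets of any size; [n] will be the rounded-up
    bound on the list size. *)
Lemma counting_injection (R : realType) (A : set nat) (c : R) (n : nat) :
  (c%:E <= counting A)%E -> (forall m, c <= m%:R -> (n <= m)%N) ->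
  exists f : 'I_n -> nat, injective f /\ forall i, A (f i).
Proof.
move=> cA minn.
have [B [BA Bn]] : exists B : {fset nat}, ([set` B] `<=` A)%classic /\ (n <= #|` B|)%N.
  have [finA|infA] := pselect (finite_set A).
    exists (fset_set A); rewrite fset_setK //; split=> //.
    by apply: minn; move: cA; rewrite /counting asboolT // lee_fin.
  by have [B BA Bn] := infinite_set_fset n infA; exists B.
exists (fun i : 'I_n => nth 0%N (enum_fset B) i); split=> [i j ij|i].
  have lt k : (k < n)%N -> (k < size (enum_fset B))%N by move/leq_trans; apply.
  apply: val_inj; apply/eqP; rewrite -(nth_uniq 0%N (lt _ (ltn_ord i)) (lt _ (ltn_ord j)) (fset_uniq B)).
  exact/eqP.
by apply: BA => /=; apply: mem_nth; apply: leq_trans Bn.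
Qed.

End Counting.

(** * Adjacency, short cycles and labels *)

Section Graph.
Import mathcomp.boot.fintype mathcomp.boot.finset.
Variable G : multigraph.
Implicit Types (u v w z : vertex G) (e : edge G).

Definition adjacent u v := [exists e : edge G, ends e == [set u; v]%SET].

Lemma adjacent_sym : symmetric adjacent.
Proof. by move=> u v; apply: eq_existsb => e; rewrite finset.setUC. Qed.

Lemma ends_neq e u v : ends e = [set u; v]%SET -> u != v.
Proof.
by move=> Ee; have := card_ends e; rewrite Ee cards2; case: (u != v).
Qed.

Lemma adjacent_irr : irreflexive adjacent.
Proof. by move=> u; apply/existsP => -[e /eqP /ends_neq]; rewrite eqxx. Qed.

Lemma adjacent_neq u v : adjacent u v -> u != v.
Proof. by apply: contraTneq => ->; rewrite adjacent_irr. Qed.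

Lemma card_adjacent v : (#|[set u | adjacent v u]%SET| <= degree v)%N.
Proof.
apply: (card_le_rel (r := fun u e => ends e == [set v; u]%SET)).
  move=> u; rewrite inE => /existsP[e /eqP Ee]; exists e; rewrite ?Ee //.
  by rewrite inE Ee !inE eqxx.
move=> u u' e /eqP E /eqP E'; have := set22 v u; rewrite -E E' !inE => /orP[/eqP uv|/eqP //].
by move: (ends_neq E); rewrite uv eqxx.
Qed.

Lemma ends_neq_edge e e' a b c d : ends e = [set a; b]%SET -> ends e' = [set c; d]%SET ->
  (a != c) && (a != d) || (b != c) && (b != d) -> e != e'.
Proof.
move=> Ee Ee' + ; apply: contraTneq => ee.
have := set22 a b; have := set21 a b; rewrite -Ee ee Ee' !inE.
by rewrite -!negb_or -negb_and negbK => -> ->.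
Qed.

Lemma cycle_of_seq (vs : seq (vertex G)) (es : seq (edge G)) v0 e0 k :
  size vs = k -> size es = k -> uniq vs -> uniq es ->
  (forall i : 'I_k, ends (nth e0 es i) = [set nth v0 vs i; nth v0 vs (ordS i)]%SET) ->
  has_cycle G k.
Proof.
move=> svs ses uvs ues E.
exists (fun i => nth v0 vs i), (fun i => nth e0 es i); split=> // i j /eqP.
  by rewrite nth_uniq ?svs ?ltn_ord // => /eqP/val_inj.
by rewrite nth_uniq ?ses ?ltn_ord // => /eqP/val_inj.
Qed.

Lemma adjacent_C3 u v w : ~ has_cycle G 3 ->
  adjacent u v -> adjacent v w -> adjacent w u -> False.
Proof.
move=> noC3 uv vw wu; apply: noC3.
have [nuv nvw nwu] := And3 (adjacent_neq uv) (adjacent_neq vw) (adjacent_neq wu).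
have [nvu nwv nuw] : [/\ v != u, w != v & u != w] by split; rewrite eq_sym.
move: uv vw wu => /existsP[e0 /eqP E0] /existsP[e1 /eqP E1] /existsP[e2 /eqP E2].
apply: (@cycle_of_seq [:: u; v; w] [:: e0; e1; e2] u e0) => //.
- by rewrite /= !inE !negb_or nuv nvw nuw.
- rewrite /= !inE !negb_or (ends_neq_edge E0 E1) ?(ends_neq_edge E0 E2) ?(ends_neq_edge E1 E2) //;
    by rewrite ?nuv ?nuw ?nvu ?nvw ?nwu ?nwv ?orbT.
- by case=> [[|[|[|//]]] ?].
Qed.

(** A closed walk of length 4 is a cycle unless two opposite vertices coincide. *)
Lemma adjacent_C4 u v w z : ~ has_cycle G 4 ->
  adjacent u v -> adjacent v w -> adjacent w z -> adjacent z u -> u = w \/ v = z.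
Proof.
move=> noC4 uv vw wz zu; have [->|nuw] := eqVneq u w; first by left.
have [->|nvz] := eqVneq v z; first by right.
case: noC4.
have [nuv nvw nwz nzu] := And4 (adjacent_neq uv) (adjacent_neq vw) (adjacent_neq wz) (adjacent_neq zu).
have [[nvu nwv nzw] [nuz nwu nzv]] : [/\ v != u, w != v & z != w] /\ [/\ u != z, w != u & z != v].
  by split; split; rewrite eq_sym.
move: uv vw wz zu => /existsP[e0 /eqP E0] /existsP[e1 /eqP E1] /existsP[e2 /eqP E2] /existsP[e3 /eqP E3].
apply: (@cycle_of_seq [:: u; v; w; z] [:: e0; e1; e2; e3] u e0) => //.
- by rewrite /= !inE !negb_or nuv nuw nuz nvw nvz nwz.
- rewrite /= !inE !negb_or (ends_neq_edge E0 E1) ?(ends_neq_edge E0 E2) ?(ends_neq_edge E0 E3)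
    ?(ends_neq_edge E1 E2) ?(ends_neq_edge E1 E3) ?(ends_neq_edge E2 E3) //;
    by rewrite ?nuv ?nuw ?nuz ?nvu ?nvw ?nvz ?nwu ?nwv ?nwz ?nzu ?nzv ?nzw ?orbT.
- by case=> [[|[|[|[|//]]]] ?].
Qed.

Variable tau : edge_labelling G.

Lemma labelled_ends e u v c c' : labelled tau e u v c c' -> ends e = [set u; v]%SET.
Proof.
rewrite (end12 tau) => /orP[] /and3P[/eqP -> /eqP -> _] //.
exact: finset.setUC.
Qed.

Lemma labelled_sym e u v c c' : labelled tau e u v c c' = labelled tau e v u c' c.
Proof. exact: orbC. Qed.

(** Without loops, only one of the two readings of [e] starts at [u], so each edge accounts for a
    single conflict there. *)
Lemma labelled_inj e u v v' c c' b b' :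
  labelled tau e u v c c' -> labelled tau e u v' b b' -> [/\ v = v', c = b & c' = b'].
Proof.
move=> lab; have := ends_neq (labelled_ends lab); move: lab.
rewrite /labelled => /orP[] /and3P[/eqP e1 /eqP e2 /eqP ->] neq /orP[] /and3P[/eqP e1' /eqP e2' /eqP[]].
- by rewrite -e2 -e2' => -> ->.
- by move: neq; rewrite -e2 e2' eqxx.
- by move: neq; rewrite -e1 e1' eqxx.
- by rewrite -e1 -e1' => -> ->.
Qed.
End Graph.

(** * Colouring from lists of equal length *)

Section Colouring.
Import mathcomp.boot.fintype mathcomp.boot.finset.
Variables (R : realType) (G : multigraph) (tau : edge_labelling G) (n D : nat) (L : R).
Variable col : vertex G -> 'I_n -> nat.
Hypothesis col_inj : forall v, injective (col v).
Hypothesis noC3 : ~ has_cycle G 3.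
Hypothesis noC4 : ~ has_cycle G 4.
Hypothesis Delta_L : (max_degree G)%:R = expR L.
Hypothesis L_large : 20 ^+ 5 * 1000 <= L.
Hypothesis L_ge : 16 <= L.
Hypothesis n_large : 2500 * expR L <= n%:R ^+ 2 * L.
Hypothesis n_le : n%:R <= expR L.
Hypothesis D_conflict : (conflict_degree tau <= D)%N.
Hypothesis D_gt0 : (0 < D)%N.
Hypothesis D_le : D%:R <= expR (L / 5).

(** A node is a vertex with the index of one of its [n] chosen colours. *)
Let X := (vertex G * 'I_n)%type.
Let pi (x : X) := x.1.
Let conf (x y : X) :=
  [exists e, labelled tau e x.1 y.1 (col x.1 x.2) (col y.1 y.2)].

Let conf_sym : symmetric conf.
Proof. by move=> x y; apply: eq_existsb => e; apply: labelled_sym. Qed.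

Let conf_adj x y : conf x y -> adjacent (pi x) (pi y).
Proof.
by move=> /existsP[e /labelled_ends E]; apply/existsP; exists e; apply/eqP.
Qed.

Let conf_mult (x : X) u : (#|[set y | conf x y && (pi y == u)]%SET| <= D)%N.
Proof.
apply: leq_trans D_conflict; move/conflict_degreeP: (leqnn (conflict_degree tau)).
move=> /(_ (col x.1 x.2) x.1 u); apply: leq_trans.
apply: (card_le_rel (r := fun (y : X) e => (y.1 == u) && labelled tau e x.1 y.1 (col x.1 x.2) (col y.1 y.2))).
  move=> y; rewrite inE => /andP[/existsP[e lab] /eqP yu]; exists e.
    by rewrite inE; apply/asboolP; exists (col y.1 y.2); rewrite -yu.
  by rewrite lab -yu eqxx.
move=> [v i] [v' i'] e /= /andP[_ lab] /andP[_ lab'].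
have [vv _ cc] := labelled_inj lab lab'; rewrite -{v'}vv in cc lab' *.
by rewrite (col_inj cc).
Qed.

(** Every edge at [v] forbids one pair of colours, so it is charged at most once. *)
Let sum_cdeg v : (\sum_(x in part pi setT v) cdeg conf setT x <= max_degree G)%N.
Proof.
rewrite sum_cdeg_part; apply: (@leq_trans (degree v)); last exact: leq_bigmax.
apply: (card_le_rel (r := fun (q : X * X) e => (q.1.1 == v) &&
  labelled tau e q.1.1 q.2.1 (col q.1.1 q.1.2) (col q.2.1 q.2.2))).
  move=> q; rewrite !inE => /and3P[/eqP qv _ /existsP[e lab]]; exists e.
    by rewrite inE (labelled_ends lab) -qv set21.
  by rewrite lab -qv eqxx.
move=> [[v1 i1] [u1 j1]] [[v2 i2] [u2 j2]] e /= /andP[/eqP -> lab] /andP[/eqP -> lab'].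
have [uu ci cj] := labelled_inj lab lab'; rewrite -{u2}uu in cj lab' *.
by rewrite (col_inj ci) (col_inj cj).
Qed.

Lemma colouring_from_lists : exists sigma : vertex G -> nat,
  (forall v, exists i, sigma v = col v i) /\
  ~ (exists e u v, labelled tau e u v (sigma u) (sigma v)).
Proof.
have L0 : 0 < L by apply: lt_le_trans L_ge.
have n0 : (0 < n)%N.
  rewrite lt0n; apply: contraTneq n_large => ->.
  by rewrite expr0n mul0r -ltNge; apply: mulr_gt0 (ltr0Sn _ 2499) (expR_gt0 L).
have nR0 : (0 : R) < n%:R by rewrite ltr0n.
(* Twice the bound exp(L)/n on the average degree in a list; by Markov's inequality at least half of
   each list stays below it. *)
pose t : R := 2 * expR L / n%:R.
have tn : t * n%:R = 2 * expR L by rewrite divfK // gt_eqF.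
have t0 : 0 < t by rewrite divr_gt0 // mulr_gt0 // expR_gt0.
pose l := uphalf n.
have nl : n%:R <= 2 * l%:R :> R.
  by rewrite -natrM ler_nat mul2n -leq_uphalf_double.
have l_n : (l <= n)%N by rewrite /l leq_uphalf_double -addnn leq_addr.
have l0 : (0 < l)%N by rewrite /l uphalf_gt0.
pose A : {set X} := [set x | (cdeg conf setT x)%:R <= t]%SET.
have A_part v : (l <= #|part pi A v|)%N.
  set P := part pi setT v.
  have P_card : #|P| = n.
    have -> : P = [set (v, i) | i in setT]%SET.
      apply/setP => -[u i]; rewrite !inE /=; apply/eqP/imsetP => [->|[j _ [-> _]]] //.
      by exists i.
    by rewrite card_imset ?cardsT ?card_ord // => i j [].
  have <- : P :&: A = part pi A v by apply/setP => x; rewrite !inE andbC.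
  have bad : #|P :\: A|%:R * t <= expR L.
    rewrite -Delta_L; apply: (@le_trans _ _ (\sum_(x in P) cdeg conf setT x)%:R); last first.
      by rewrite ler_nat sum_cdeg.
    rewrite natr_sum (big_setID A) /= mulr_natl -sumr_const; apply: ler_wpDl.
      exact: sumr_ge0.
    by apply: ler_sum => x; rewrite !inE => /andP[+ _]; rewrite -ltNge => /ltW.
  have bad2 : (#|P :\: A|.*2 <= n)%N.
    rewrite -(ler_nat R) -mul2n natrM -(ler_pM2r t0) -mulrA.
    apply: le_trans (ler_wpM2l (ler0n _ 2) bad) _.
    by rewrite [n%:R * t]mulrC tn.
  rewrite /l leq_uphalf_double -(leq_add2r #|P :\: A|.*2) -doubleD cardsID P_card.
  by rewrite -[n.*2]addnn leq_add2l.
have [B [BA B_part B_cover]] := trim_parts l0 (fun x (_ : x \in A) => A_part (pi x)).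
(* The number of rounds: t / l starts at no more than L/625 and drops by 1/128 each time. *)
have [N [N_ge N_le]] : exists N : nat, 128 * L / 625 <= N%:R /\ N%:R <= 128 * L / 625 + 1.
  have N0 : 0 <= 128 * L / 625 :> R.
    exact: divr_ge0 (mulr_ge0 (ler0n _ 128) (ltW L0)) (ler0n _ 625).
  have exN : exists N : nat, 128 * L / 625 <= N%:R.
    by exists (Num.bound (128 * L / 625)); apply: ltW; apply: archi_boundP.
  have [N N_ge N_min] := ex_minnP exN; exists N; split=> //.
  case: N N_ge N_min => [|N] _ N_min; first by apply: addr_ge0.
  rewrite -natr1 lerD2r leNgt; apply/negP => /ltW /N_min.
  by rewrite ltnn.
have l2 : 625 * expR L <= l%:R ^+ 2 * L.
  have nl2 : n%:R ^+ 2 <= 4 * l%:R ^+ 2 :> R.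
    have -> : 4 * l%:R ^+ 2 = (2 * l%:R) ^+ 2 :> R by rewrite exprMn; congr (_ * _); ring.
    by rewrite lerXn2r ?nnegrE ?mulr_ge0.
  move: n_large (ler_wpM2r (ltW L0) nl2); rewrite -[4 * _ * L]mulrA.
  move: (_ ^+ 2 * L) (_ ^+ 2 * L) (expR L) => a b e; lra.
(* The constant 50 enters here: n^2 L >= 2500 exp(L) and 2 l >= n give l n L >= 1250 exp(L). *)
have tL : t <= L / 625 * l%:R.
  rewrite -(ler_pM2r nR0) tn.
  have nl2 := ler_wpM2l (mulr_ge0 (ler0n R n) (ltW L0)) nl.
  have -> : L / 625 * l%:R * n%:R = n%:R * L * (2 * l%:R) / 1250 by field.
  move: n_large nl2; rewrite expr2 [n%:R * L * n%:R]mulrAC.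
  move: (n%:R * L * _) (n%:R * n%:R * L) (expR L) => a b e; lra.
have [T [TB T_ind T_cover]] : exists T : {set X}, indep_transversal pi conf B T.
  apply: (@iterate_nibble R _ _ pi conf (@adjacent G) conf_sym (@adjacent_sym G)
     (@adjacent_irr G) conf_adj (fun u v w => adjacent_C3 noC3)
     (fun u v w z => adjacent_C4 noC4) (max_degree G) D L _ conf_mult D_gt0 L_ge _ N B l t) => //.
  - by move=> v; apply: leq_trans (card_adjacent v) _; exact: leq_bigmax.
  - by rewrite Delta_L.
  - move=> x xB; have := subsetP BA _ xB; rewrite inE; apply: le_trans.
    by rewrite ler_nat; apply: cdeg_mono; apply: subsetT.
  - exact: ltW.
  - apply: le_trans tL _; apply: ler_wpM2r => //.
    have -> : L / 625 = 128 * L / 625 / 128 by field.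
    move: N_ge; move: (128 * L / 625) (N%:R : R) => a b; lra.
  - exact: large_lists.
  - by apply: le_trans n_le; rewrite ler_nat.
have T_hit v : exists i, (v, i) \in T.
  have /card_gt0P[x] : (0 < #|part pi A v|)%N := leq_trans l0 (A_part v).
  rewrite inE => /andP[xA /eqP <-].
  have [y yB <-] := B_cover x xA; have [[u i] zT <-] := T_cover y yB.
  by exists i.
have [i iT] := choice T_hit.
exists (fun v => col v (i v)); split=> [v|[e [u [v lab]]]]; first by exists (i v).
by case/negP: (T_ind _ _ (iT u) (iT v)); apply/existsP; exists e.
Qed.
End Colouring.

(** Here [s] is the square root of Delta / ln Delta and [n] is 50 s rounded up. The upper bound is
    50 s + 1 <= 51 s^2 <= L s^2. *)
Lemma list_length_bounds (R : realType) (L s : R) (n : nat) : 51 <= L -> 0 <= s ->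
  s ^+ 2 * L = expR L -> 50 * s <= n%:R -> (forall m, 50 * s <= m%:R -> (n <= m)%N) ->
  2500 * expR L <= n%:R ^+ 2 * L /\ n%:R <= expR L.
Proof.
move=> L51 s0 sL sn n_min; have L0 : 0 < L by lra.
split.
  rewrite -sL mulrA; apply: ler_wpM2r; first exact: ltW.
  have -> : 2500 * s ^+ 2 = (50 * s) ^+ 2 by ring.
  by rewrite lerXn2r ?nnegrE ?mulr_ge0.
have s1 : 1 <= s.
  rewrite -(@ler_sqr _ 1 s) ?nnegrE // expr1n -(ler_pM2r L0) mul1r sL.
  by apply: le_trans (expR_ge1Dx L); rewrite lerDr.
apply: (@le_trans _ _ (50 * s + 1)).
  case: n sn n_min => [|n] _ n_min; first by apply: addr_ge0 => //; apply: mulr_ge0.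
  rewrite -natr1 lerD2r leNgt; apply/negP => /ltW /n_min.
  by rewrite ltnn.
rewrite -sL; have s2 : s <= s ^+ 2 by rewrite expr2 -[leLHS]mulr1; apply: ler_wpM2l.
have := ler_wpM2l (sqr_ge0 s) L51; lra.
Qed.

(* [counting A] is the cardinality of the set A, as an extended real. *)
Theorem corollary1p6 (R : realType) :
  exists Delta0 : nat,
    forall (G : multigraph) (Delta : nat) (L : vertex G -> set nat)
           (tau : edge_labelling G),
      max_degree G = Delta ->
      (Delta0 < Delta)%N ->
      ~ has_cycle G 3 ->
      ~ has_cycle G 4 ->
      (forall v : vertex G,
        ((50 * Num.sqrt (Delta%:R / ln Delta%:R) : R)%:E <= counting (L v))%E) ->
      (conflict_degree tau)%:R <= (Delta%:R : R) `^ (1 / 5) ->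
      exists sigma : vertex G -> nat, proper_conflict_colouring L tau sigma.
Proof.
pose K : R := 20 ^+ 5 * 1000 + 51.
exists (Num.bound (expR K)) => G Delta L tau maxG Delta_gt noC3 noC4 L_size tau_deg.
have K_Delta : expR K < Delta%:R.
  by apply: lt_trans (archi_boundP (expR_ge0 K)) _; rewrite ltr_nat.
have Delta0 : 0 < Delta%:R :> R := lt_trans (expR_gt0 K) K_Delta.
pose l : R := ln Delta%:R.
have el : expR l = Delta%:R by rewrite lnK.
have Kl : K <= l by rewrite -ler_expR el ltW.
have l_large : 20 ^+ 5 * 1000 <= l.
  by apply: le_trans Kl; rewrite lerDl; apply: ler0n.
have l51 : 51 <= l.
  apply: le_trans Kl; rewrite lerDr.
  exact: mulr_ge0 (exprn_ge0 5 (ler0n R 20)) (ler0n R 1000).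
have l16 : 16 <= l by lra.
have l0 : 0 < l by lra.
pose s : R := Num.sqrt (Delta%:R / l).
have sl : s ^+ 2 * l = expR l.
  by rewrite sqr_sqrtr ?divfK ?el ?gt_eqF // divr_ge0 // ltW.
have [n sn n_min] : exists2 n : nat, 50 * s <= n%:R & forall m, 50 * s <= m%:R -> (n <= m)%N.
  have ex_n : exists n : nat, 50 * s <= n%:R.
    exists (Num.bound (50 * s)); apply: ltW; apply: archi_boundP.
    by apply: mulr_ge0; [exact: ler0n | exact: sqrtr_ge0].
  by have [n sn n_min] := ex_minnP ex_n; exists n.
have [n_large n_le] := list_length_bounds l51 (sqrtr_ge0 _) sl sn n_min.
have [col col_inj] := choice (fun v => counting_injection (L_size v) n_min).
have [sigma [sigma_col sigma_proper]] : exists sigma : vertex G -> nat,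
    (forall v, exists i, sigma v = col v i) /\
    ~ (exists e u v, labelled tau e u v (sigma u) (sigma v)).
  (* The maximum with 1 makes [D] positive even if the conflict degree is 0. *)
  apply: (@colouring_from_lists R G tau n (maxn 1 (conflict_degree tau)) l) => //.
  - by move=> v; case: (col_inj v).
  - by rewrite maxG el.
  - exact: leq_maxr.
  - by rewrite leq_max.
  - rewrite /maxn; case: ifP => _; last first.
      by rewrite -expR0 ler_expR divr_ge0 // ltW.
    apply: le_trans tau_deg _.
    by rewrite /powR gt_eqF // ler_expR mul1r mulrC.
exists sigma; split=> // v; have [i ->] := sigma_col v.
by case: (col_inj v).
Qed.
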